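(* Let $T^\circ(\omega,\mathrm x)\in L_2(\Omega\times\mathbb S^2)$ be the observed random field, and let $T^*(\omega,\mathrm x)=\sum_{l=0}^\infty\sum_{m=-l}^l\alpha^*_{l,m}(\omega)Y_{l,m}(\mathrm x)$ be the random field defined by scaled KKT points $\alpha^*(\omega)\in\ell^p_\beta$, $\omega\in\Omega$, of $$\min_{\alpha\in\ell^p_\beta}\ \|\alpha\|_{2,p}^p\quad\text{s.t.}\quad \alpha^HY\alpha-2\mathrm{Re}(\alpha^H\alpha^\circ(\omega))+c(\omega)\le\varrho ,$$ as described in the context. Then for any $\epsilon>0$ there exists $L$ such that $$0\le\|\mathcal A(T^*_L(\omega,\mathrm x))-T^\circ(\omega,\mathrm x)\|^2_{L_2(\Omega\times\mathbb S^2)}-\varrho<\epsilon,$$ where $T^*_L(\omega,\mathrm x)=\sum_{l=0}^L\sum_{m=-l}^l\alpha^*_{l,m}(\omega)Y_{l,m}(\mathrm x)$.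
   Context: $(\Omega,\mathcal F,P)$ is a probability space. $\mathbb S^2\subset\mathbb R^3$ is the unit sphere with Borel sigma algebra $\mathfrak B(\mathbb S^2)$ and surface measure $\sigma$, $\sigma(\mathbb S^2)=4\pi$. A real-valued random field on $\mathbb S^2$ is an $\mathcal F\otimes\mathfrak B(\mathbb S^2)$-measurable function $\Omega\times\mathbb S^2\to\mathbb R$. $L_2(\Omega\times\mathbb S^2)$ is the $L_2$ space for the product measure $P\otimes\sigma$, so $\|T\|^2_{L_2(\Omega\times\mathbb S^2)}=\mathbb E\big[\|T(\omega,\cdot)\|^2_{L_2(\mathbb S^2)}\big]$. $Y_{l,m}$ ($l\in\mathbb N_0$, $-l\le m\le l$) are the complex spherical harmonics, an orthonormal basis of $L_2(\mathbb S^2)$. $\Gamma\subset\mathbb S^2$ is a measurable set containing a nonempty open subset of $\mathbb S^2$, with $\mathbb S^2\setminus\Gamma$ nonempty; the inpainting operator $\mathcal A$ is given by $\mathcal A(T)=T$ on $\Gamma$ and $\mathcal A(T)=0$ on $\mathbb S^2\setminus\Gamma$. The observed field $T^\circ$ is real-valued and of the form $\mathcal A(T^{\rm true})+\Delta$, where $T^{\rm true}\in L_2(\Omega\times\mathbb S^2)$ is the unknown true random field, whose expected value and covariance are rotationally invariant, and $\Delta:\Omega\times\mathbb S^2\to\mathbb R$ is observational noise. Fix $0<p<1$, $\eta>1$; $\beta_0=1$, $\beta_l=\eta^ll^p$ for $l\ge1$. Coefficient vectors are grouped as $\alpha=(\alpha_{0\cdot}^T,\alpha_{1\cdot}^T,\dots)^T$,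 $\alpha_{l\cdot}=(\alpha_{l,-l},\dots,\alpha_{l,l})^T\in\mathbb C^{2l+1}$; $\|\cdot\|$ is the $\ell_2$ norm; $\|\alpha\|_{2,p}^p=\sum_{l\ge0}\beta_l\|\alpha_{l\cdot}\|^p$; $\ell^p_\beta=\{\alpha:\sum_l\|\alpha_{l\cdot}\|^2<\infty,\ \|\alpha\|_{2,p}^p<\infty\}$. $Y$ is the infinite matrix with entry $\int_\Gamma\overline{Y_{l,m}}\,Y_{l',m'}\,d\sigma$ in row $(l,m)$, column $(l',m')$; $Y_{l\cdot}$ is its block of rows of degree $l$. For each $\omega$: $\alpha^\circ(\omega)$ has entries $\alpha^\circ_{l,m}(\omega)=\int_\Gamma T^\circ(\omega,\mathrm x)\overline{Y_{l,m}(\mathrm x)}\,d\sigma(\mathrm x)$, and $c(\omega)=\int_{\mathbb S^2}|T^\circ(\omega,\mathrm x)|^2d\sigma(\mathrm x)$. The number $\varrho$ satisfies $\int_{\mathbb S^2\setminus\Gamma}|T^\circ(\omega,\mathrm x)|^2d\sigma(\mathrm x)<\varrho<c(\omega)$ for each $\omega$ (so $\alpha=0$ is not feasible). A vector $\alpha^*(\omega)\in\ell^p_\beta$ is a scaled KKT point of the problem in the claim if there is $\nu_\omega\in\mathbb R$ with: $p\beta_l\|\alpha^*_{l\cdot}(\omega)\|^p\alpha^*_{l\cdot}(\omega)+2\nu_\omega\|\alpha^*_{l\cdot}(\omega)\|^2(Y_{l\cdot}\alpha^*(\omega)-\alpha^\circ_{l\cdot}(\omega))=0$ for all $l\in\mathbb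 N_0$; $\nu_\omega\big(\alpha^*(\omega)^HY\alpha^*(\omega)-2\mathrm{Re}(\alpha^*(\omega)^H\alpha^\circ(\omega))+c(\omega)-\varrho\big)=0$; $\alpha^*(\omega)^HY\alpha^*(\omega)-2\mathrm{Re}(\alpha^*(\omega)^H\alpha^\circ(\omega))+c(\omega)\le\varrho$; $\nu_\omega\ge0$. For each $\omega\in\Omega$ there is a finite $L_\omega\in\mathbb N_0$ such that $\alpha^*(\omega)=(\hat\alpha^*(\omega)^T,0,0,\dots)^T$, i.e. $\alpha^*_{l,m}(\omega)=0$ for all $l>L_\omega$, where $\hat\alpha^*(\omega)\in\mathbb C^{(L_\omega+1)^2}$ is a scaled KKT point of the corresponding problem truncated to degrees $l\le L_\omega$ (the same conditions with $Y$, $\alpha^\circ(\omega)$ and $\mathbb N_0$ restricted to degrees at most $L_\omega$), and $\alpha^*(\omega)$ is a scaled KKT point of the infinite-dimensional problem.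
   Formalization: The random field T* is additionally assumed to belong to L_2(Ω×S²); without this the claim fails, since the degrees L_ω may be unbounded and T*_L may then have infinite norm on Γ for every L. *)

(* Defs.v *)
From HB Require Import structures.
From mathcomp Require Import all_boot all_order all_algebra.
From mathcomp Require Import complex.
From mathcomp Require Import all_classical all_reals all_analysis measurable_realfun.

Set Implicit Arguments.
Unset Strict Implicit.
Unset Printing Implicit Defensive.
Import Order.TTheory GRing.Theory Num.Theory.
Import numFieldNormedType.Exports.

Local Open Scope classical_set_scope.
Local Open Scope ring_scope.
Local Open Scope complex_scope.

Definition sphere_set (R : realType) : set 'rV[R]_3 :=
  [set x | \sum_(i < 3) x ord0 i ^+ 2 = 1].

Arguments sphere_set R : clear implicits.

Definition sphere (R : realType) : Type := set_type (sphere_set R).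

(* Subspace topology of R^3; the sigma-algebra declared below is Borel's. *)
HB.instance Definition _ (R : realType) :=
  Topological.copy (sphere R) (set_type (sphere_set R)).

Section spherical_coordinates.
Variable R : realType.

(* t = (theta, phi): colatitude and longitude. *)
Definition sph_vec (t : R * R) : 'rV[R]_3 :=
  \row_i [:: sin t.1 * cos t.2; sin t.1 * sin t.2; cos t.1]`_i.

Lemma sph_vec_subproof (t : R * R) : sph_vec t \in sphere_set R.
Proof.
rewrite inE /sphere_set /= !big_ord_recl big_ord0 !mxE /=.
by rewrite addr0 !exprMn addrA -mulrDr cos2Dsin2 mulr1 addrC cos2Dsin2.
Qed.

Definition sph_point (t : R * R) : sphere R :=
  exist _ (sph_vec t) (sph_vec_subproof t).

End spherical_coordinates.

HB.instance Definition _ (R : realType) :=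
  isPointed.Build (sphere R) (sph_point (0, 0)).

HB.instance Definition _ (R : realType) :=
  Measurable.copy (sphere R) (g_sigma_algebraType (@open (sphere R))).

Section surface_measure.
Variable R : realType.
Implicit Types (U : set (R * R)) (A : set (sphere R)).

Lemma open_measurable_prod U : open U ->
  measurable (U : set (measurableTypeR R * measurableTypeR R)).
Proof.
move=> oU.
pose box (q : (rat * rat) * (rat * rat)) : set (R * R) :=
  `]ratr q.1.1, ratr q.1.2[%classic `*` `]ratr q.2.1, ratr q.2.2[%classic.
have -> : U = \bigcup_(q in [set q | box q `<=` U]) box q.
  apply/seteqP; split=> [[x y] Uxy|t [q /= sqU /sqU //]].
  have /nbhs_ballP[e /= e0 eU] : nbhs (x, y) U by exact: open_nbhs_nbhs.
  have ratD (z : R) : exists a b : rat,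
      [/\ z - e < ratr a, ratr a < z, z < ratr b & ratr b < z + e].
    have /rat_in_itvoo[a] : z - e < z by rewrite ltrBlDr ltrDl.
    have /rat_in_itvoo[b] : z < z + e by rewrite ltrDl.
    rewrite !in_itv/= => /andP[? ?] /andP[? ?].
    by exists a, b; split.
  have [a [b [a1 a2 b1 b2]]] := ratD x.
  have [c [f [c1 c2 f1 f2]]] := ratD y.
  exists ((a, b), (c, f)) => /=; last by split; rewrite /= in_itv /=; apply/andP; split.
  move=> [u v] [/=]; rewrite !in_itv/= => /andP[au ub] /andP[cv vf].
  apply: eU; split => /=; rewrite /ball/= ltr_distlC.
    by rewrite (lt_trans a1 au) (lt_trans ub b2).
  by rewrite (lt_trans c1 cv) (lt_trans vf f2).
rewrite bigcup_mkcond; apply: countable_bigcupT_measurable => // q.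
by case: ifPn => // _; apply: measurableX; exact: measurable_itv.
Qed.

Lemma sph_vec_continuous : continuous (@sph_vec R).
Proof.
have cF i t : {for t, continuous (fun s => @sph_vec R s ord0 i)}.
  have cs1 : {for t, continuous (fun s : R * R => sin s.1)}.
    by apply: (continuous_comp (g := @sin R)); [exact: cvg_fst|exact: continuous_sin].
  have cc1 : {for t, continuous (fun s : R * R => cos s.1)}.
    by apply: (continuous_comp (g := @cos R)); [exact: cvg_fst|exact: continuous_cos].
  have cs2 : {for t, continuous (fun s : R * R => sin s.2)}.
    by apply: (continuous_comp (g := @sin R)); [exact: cvg_snd|exact: continuous_sin].
  have cc2 : {for t, continuous (fun s : R * R => cos s.2)}.
    by apply: (continuous_comp (g := @cos R)); [exact: cvg_snd|exact: continuous_cos].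
  rewrite (_ : (fun s => _) = fun s : R * R =>
      [:: sin s.1 * cos s.2; sin s.1 * sin s.2; cos s.1]`_i); last first.
    by apply/funext => s; rewrite mxE.
  by case: i => [[|[|[|//]]] ?] /=; [exact: cvgM|exact: cvgM|].
move=> t A [P MP sPA].
have : \forall s \near t, forall j, P ord0 j (@sph_vec R s ord0 j).
  apply: (@filter_forall _ _ (fun j s => P ord0 j (sph_vec s ord0 j)) _ (nbhs_filter t)) => j.
  exact: (cF j t _ (MP ord0 j)).
by apply: filterS => s Ps; apply: sPA => i j; rewrite (ord1 i).
Qed.

Lemma sph_point_continuous : continuous (@sph_point R).
Proof.
apply/continuousP => _ [W oW <-].
by move/continuousP : sph_vec_continuous => /(_ _ oW).
Qed.

Lemma measurable_sph_point : measurable_fun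
  [set: measurableTypeR R * measurableTypeR R] (@sph_point R).
Proof.
apply: (measurability (@open (sphere R))) => // _ [U oU <-].
rewrite setTI; apply: open_measurable_prod.
by have /continuousP := sph_point_continuous; exact.
Qed.

Definition sph_rect : set (measurableTypeR R * measurableTypeR R) :=
  `[0, pi]%classic `*` `[0, pi *+ 2]%classic.

(* d sigma = sin theta d theta d phi. *)
Definition surface_measure A : \bar R :=
  (\int[lebesgue_measure \x lebesgue_measure]_(t in
      sph_rect `&` @sph_point R @^-1` A) (@sin R t.1)%:E)%E.

Lemma measurable_sph_rect A : measurable A -> measurable (sph_rect `&` @sph_point R @^-1` A).
Proof.
move=> mA; apply: measurableI; last first.
  by rewrite -[X in measurable X]setTI; exact: measurable_sph_point.
by apply: measurableX; exact: measurable_itv.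
Qed.

Lemma measurable_sin1 (D : set (measurableTypeR R * measurableTypeR R)) :
  measurable_fun D (fun t => (@sin R t.1)%:E).
Proof.
apply: measurable_funTS; apply/measurable_EFinP; apply: measurableT_comp => //.
apply: continuous_measurable_fun; exact: continuous_sin.
Qed.

Lemma sin_sph_rect_ge0 A t : (sph_rect `&` @sph_point R @^-1` A) t -> (0 <= (@sin R t.1)%:E)%E.
Proof.
by move=> [[/= + _] _]; rewrite in_itv/= lee_fin => /sin_ge0_pi.
Qed.

Lemma surface_measure0 : surface_measure set0 = 0%E.
Proof. by rewrite /surface_measure preimage_set0 setI0 integral_set0. Qed.

Lemma surface_measure_ge0 A : (0 <= surface_measure A)%E.
Proof. by apply: integral_ge0 => t /sin_sph_rect_ge0. Qed.

Lemma surface_measure_sigma_additive : semi_sigma_additive surface_measure.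
Proof.
move=> F mF tF mUF; rewrite /surface_measure.
rewrite preimage_bigcup setI_bigcupr ge0_integral_bigcup//=.
- apply: is_cvg_ereal_nneg_natsum_cond => n _ _.
  by apply: integral_ge0 => t /sin_sph_rect_ge0.
- by move=> n; exact: measurable_sph_rect.
- exact: measurable_sin1.
- by move=> t [n _ /sin_sph_rect_ge0].
- apply/trivIsetP => i j _ _ ij; rewrite setIACA setIid -preimage_setI.
  move/trivIsetP : tF => /(_ i j Logic.I Logic.I ij) ->.
  by rewrite preimage_set0 setI0.
Qed.

HB.instance Definition _ := isMeasure.Build _ _ _ surface_measure
  surface_measure0 surface_measure_ge0 surface_measure_sigma_additive.

Lemma surface_measure_finite : fin_num_fun surface_measure.
Proof.
apply: lty_fin_num_fun; rewrite /= /surface_measure.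
rewrite (_ : _ `&` _ = sph_rect); last by apply/setIidPl.
apply: (@le_lt_trans _ _
  (\int[lebesgue_measure \x lebesgue_measure]_(t in sph_rect) 1)%E).
  apply: ge0_le_integral => //.
  - by apply: measurableX; exact: measurable_itv.
  - by move=> t bt; apply: (@sin_sph_rect_ge0 setT); split.
  - exact: measurable_sin1.
  - by move=> t _; rewrite lee_fin sin_le1.
rewrite integral_cst; last by apply: measurableX; exact: measurable_itv.
rewrite mul1e [X in (X < _)%E]product_measure1E; try exact: measurable_itv.
rewrite /= !lebesgue_measure_itv.
by do 2 case: ifPn => _; rewrite ?mule0 ?mul0e -?EFinB -?EFinM ltry.
Qed.

HB.instance Definition _ :=
  @Measure_isFinite.Build _ _ _ surface_measure surface_measure_finite.

End surface_measure.
Arguments surface_measure {R}.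

Section complex_integrals_and_series.
Variable R : realType.

Definition cintegral d (T : measurableType d) (mu : {measure set T -> \bar R})
    (D : set T) (f : T -> R[i]) : R[i] :=
  (\int[mu]_(x in D) complex.Re (f x)) +i* (\int[mu]_(x in D) complex.Im (f x)).

Definition cseries (u : nat -> R[i]) : R[i] :=
  limn (series (fun n => complex.Re (u n))) +i*
  limn (series (fun n => complex.Im (u n))).

Definition cLfun d (T : measurableType d) (mu : {measure set T -> \bar R})
    (q : \bar R) (f : T -> R[i]) : Prop :=
  (fun x => complex.Re (f x)) \in Lfun mu q /\
  (fun x => complex.Im (f x)) \in Lfun mu q.

(* The L^q norm of a complex-valued function, i.e. that of its modulus. *)
Definition cLnorm d (T : measurableType d) (mu : {measure set T -> \bar R})
    (q : \bar R) (f : T -> R[i]) : \bar R :=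
  ('N[mu]_q[(fun x => (Normc.normc (f x))%:E)])%E.

End complex_integrals_and_series.

Section spherical_harmonics.
Variable R : realType.

(* Rodrigues' formula. *)
Definition legendre (l : nat) : {poly R} :=
  ((2 ^ l * l`!)%:R)^-1 *: (('X ^+ 2 - 1) ^+ l)^`(l).

(* For 0 <= m <= l this is
     sqrt ((2l+1)/(4 pi) (l-m)!/(l+m)!) P_l^m(cos theta) e^(i m phi)
   with the Condon-Shortley phase
     P_l^m(z) = (-1)^m (1 - z^2)^(m/2) (d/dz)^m P_l(z);
   in Cartesian coordinates sin(theta)^m e^(i m phi) = (x_0 + i x_1)^m and
   cos theta = x_2. *)
Definition sph_harm_nneg (l m : nat) (x : sphere R) : R[i] :=
  let v := set_val x in
  ((-1) ^+ m * Num.sqrt ((2 * l + 1)%:R / (4 * pi) * (l - m)`!%:R / (l + m)`!%:R)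
     * ((legendre l)^`(m)).[v ord0 (inord 2)])%:C
  * (v ord0 (inord 0) +i* v ord0 (inord 1)) ^+ m.

Definition sph_harm (l : nat) (m : int) (x : sphere R) : R[i] :=
  if (0 <= m)%R then sph_harm_nneg l `|m|%N x
  else (-1) ^+ `|m|%N * (sph_harm_nneg l `|m|%N x)^*.

(* The 2l+1 orders -l <= m <= l are indexed by i : 'I_(2l+1), with m = i - l. *)
Definition order_of (l : nat) (i : 'I_(l.*2.+1)) : int := i%:Z - l%:Z.

Definition Ylm (l : nat) (i : 'I_(l.*2.+1)) : sphere R -> R[i] :=
  sph_harm l (order_of i).

End spherical_harmonics.

Section random_fields.
Context (R : realType) (d : measure_display) (Omega : measurableType d).
Variable P : probability Omega R.

Definition inpainting (V : nmodType) (Gamma : set (sphere R))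
    (T : Omega * sphere R -> V) : Omega * sphere R -> V :=
  fun z => if z.2 \in Gamma then T z else 0.

(* y = Q x for a rotation Q of the sphere (points are row vectors). *)
Definition rotates (Q : 'M[R]_3) (x y : sphere R) : Prop :=
  set_val y = set_val x *m Q^T.

(* Invariance of the covariance at x = y forces the second moments to be finite
   at every point as soon as they are so at one point, in particular for a
   field in L_2. *)
Definition rotation_invariant_moments (T : Omega * sphere R -> R) : Prop :=
  forall Q : 'M[R]_3, Q *m Q^T = 1%:M -> \det Q = 1 ->
  forall x x' y y' : sphere R, rotates Q x x' -> rotates Q y y' ->
    ('E_P[(fun w => T (w, x'))] = 'E_P[(fun w => T (w, x))])%E /\
    covariance P (fun w => T (w, x')) (fun w => T (w, y')) =
    covariance P (fun w => T (w, x)) (fun w => T (w, y)).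

End random_fields.

Section coefficients.
Variable R : realType.

Definition coefs : Type := forall l : nat, 'cV[R[i]]_(l.*2.+1).

Definition hdot n (u v : 'cV[R[i]]_n) : R[i] :=
  \sum_(i < n) (u i ord0)^* * v i ord0.

Definition l2norm n (u : 'cV[R[i]]_n) : R :=
  Num.sqrt (\sum_(i < n) Normc.normc (u i ord0) ^+ 2).

Definition weight (p eta : R) (l : nat) : R :=
  if l == 0%N then 1 else eta ^+ l * l%:R `^ p.

Definition norm2p (p eta : R) (a : coefs) : \bar R :=
  (\sum_(0 <= l <oo) (weight p eta l * l2norm (a l) `^ p)%:E)%E.

Definition in_lp (p eta : R) (a : coefs) : Prop :=
  (\sum_(0 <= l <oo) (l2norm (a l) ^+ 2)%:E < +oo)%E /\
  (norm2p p eta a < +oo)%E.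

End coefficients.

Section optimization_problem.
Variables (R : realType) (Gamma : set (sphere R)).
Implicit Types (T : sphere R -> R) (a : coefs R).

Definition Yblock (l l' : nat) : 'M[R[i]]_(l.*2.+1, l'.*2.+1) :=
  \matrix_(i, j) cintegral surface_measure Gamma
                   (fun x => (Ylm i x)^* * Ylm j x).

Definition obs_coefs T : coefs R := fun l =>
  \col_i cintegral surface_measure Gamma (fun x => (T x)%:C * (Ylm i x)^*).

Definition energy T : R := \int[surface_measure]_x (T x ^+ 2).

(* The block Y_(l.) a; the row-by-column series are summed degree by degree. *)
Definition Yrow a (l : nat) : 'cV[R[i]]_(l.*2.+1) :=
  \col_i cseries (fun l' => (Yblock l l' *m a l') i ord0).

(* a^H Y a - 2 Re (a^H a°) + c; as Y is Hermitian, a^H Y a is real. *)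
Definition constraint T a : R :=
  complex.Re (cseries (fun l => hdot (a l) (Yrow a l)))
  - 2 * complex.Re (cseries (fun l => hdot (a l) (obs_coefs T l)))
  + energy T.

Definition scaled_KKT (p eta rho : R) T a : Prop :=
  in_lp p eta a /\
  exists nu : R,
    [/\ forall l,
          (p * weight p eta l * l2norm (a l) `^ p)%:C *: a l
          + (2 * nu * l2norm (a l) ^+ 2)%:C *: (Yrow a l - obs_coefs T l) = 0,
        nu * (constraint T a - rho) = 0,
        constraint T a <= rho
      & 0 <= nu].

(* The problem truncated to degrees l <= L, for vectors in C^((L+1)^2). *)

Definition Yrow_trunc (L : nat) (b : forall l : 'I_L.+1, 'cV[R[i]]_(l.*2.+1))
    (l : 'I_L.+1) : 'cV[R[i]]_(l.*2.+1) :=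
  \sum_(l' < L.+1) Yblock l l' *m b l'.

Definition constraint_trunc (L : nat) T
    (b : forall l : 'I_L.+1, 'cV[R[i]]_(l.*2.+1)) : R :=
  complex.Re (\sum_(l < L.+1) hdot (b l) (Yrow_trunc b l))
  - 2 * complex.Re (\sum_(l < L.+1) hdot (b l) (obs_coefs T l))
  + energy T.

Definition scaled_KKT_trunc (L : nat) (p eta rho : R) T
    (b : forall l : 'I_L.+1, 'cV[R[i]]_(l.*2.+1)) : Prop :=
  exists nu : R,
    [/\ forall l : 'I_L.+1,
          (p * weight p eta l * l2norm (b l) `^ p)%:C *: b l
          + (2 * nu * l2norm (b l) ^+ 2)%:C *: (Yrow_trunc b l - obs_coefs T l)
          = 0,
        nu * (constraint_trunc T b - rho) = 0,
        constraint_trunc T b <= rho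
      & 0 <= nu].

End optimization_problem.

Section inpainted_field.
Context (R : realType) (d : measure_display) (Omega : measurableType d).
Variable a : Omega -> coefs R.

Definition degree_part (l : nat) (z : Omega * sphere R) : R[i] :=
  \sum_(i < l.*2.+1) a z.1 l i ord0 * Ylm i z.2.

Definition field_of (z : Omega * sphere R) : R[i] :=
  cseries (fun l => degree_part l z).

Definition field_trunc (L : nat) (z : Omega * sphere R) : R[i] :=
  \sum_(l < L.+1) degree_part l z.

End inpainted_field.

(* Main.v *)
Require Import Defs.
From HB Require Import structures.
From mathcomp Require Import all_boot all_order all_algebra.
From mathcomp Require Import complex.
From mathcomp Require Import all_classical all_reals all_analysis.
From mathcomp Require Import measurable_realfun zify ring.

Set Implicit Arguments.
Unset Strict Implicit.
Unset Printing Implicit Defensive.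
Import Order.TTheory GRing.Theory Num.Theory.
Import numFieldNormedType.Exports.

Local Open Scope classical_set_scope.
Local Open Scope ring_scope.
Local Open Scope complex_scope.

(* For fixed w let g_L(w) be the squared L2(S^2) distance between the inpainted
   degree-L truncation of T* and the observed field, so that Fubini turns the squared
   norm of the theorem into E[g_L].  Since 0 is not feasible, the multiplier of the
   truncated problem is positive; hence the constraint is active and g_L(w) = rho as
   soon as L >= L_w.  For smaller L, dropping the high degrees can only increase the
   misfit: the KKT equations make the cross term a sum of nonnegative contributions
   p beta_l ||alpha_l||^p / nu, so g_L(w) >= rho.  Finally
   g_L <= 2 ||T*_L||^2 + 2 ||T°||^2 <= 2 ||T*||^2 + 2 ||T°||^2 by orthogonality of the
   spherical harmonics, which is integrable in w, and dominated convergence gives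
   E[g_L] -> rho.  Orthogonality is computed in spherical coordinates: different orders
   are separated by the longitude integral, different degrees by Rodrigues' formula and
   integration by parts. *)

(** * Legendre polynomials *)

Section polynomial_orthogonality.
Variable R : realType.
Implicit Types p q u v : {poly R}.

Lemma Rintegral_derive (f F : R -> R) (a b : R) : a < b -> continuous f ->
  (forall x, is_derive x (1 : R) F (f x)) ->
  \int[lebesgue_measure]_(x in `[a, b]) f x = F b - F a.
Proof.
move=> ab cf dF; have cF : continuous F.
  move=> x; apply/differentiable_continuous/derivable1_diffP.
  by have [] := dF x.
rewrite /Rintegral (@continuous_FTC2 _ f F) //.
- exact: continuous_subspaceT.
- split; first by move=> x _; have [] := dF x.
  + exact/cvg_at_right_filter/cF.
  + exact/cvg_at_left_filter/cF.
- by move=> x _; rewrite derive1E; exact: derive_val.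
Qed.

(** With x = cos t this is the integral of [p] over [-1, 1]. The factor [sin t] is kept because it
    is the density of the surface measure, so no substitution is ever performed. *)
Definition colatitude_integral p : R :=
  \int[lebesgue_measure]_(t in `[0, pi]) (p.[cos t] * sin t).

Lemma continuous_horner_cos_sin p : continuous (fun t : R => p.[cos t] * sin t).
Proof.
move=> t; apply: cvgM; last exact: continuous_sin.
apply: (@continuous_comp _ _ _ cos (horner p)); first exact: continuous_cos.
exact: continuous_horner.
Qed.

Lemma integrable_horner_cos_sin p : lebesgue_measure.-integrable `[0, pi]
  (EFin \o (fun t : R => p.[cos t] * sin t)).
Proof.
apply: continuous_compact_integrable; first exact: segment_compact.
by apply: continuous_subspaceT; exact: continuous_horner_cos_sin.
Qed.

Lemma colatitude_integralD p q :
  colatitude_integral (p + q) = colatitude_integral p + colatitude_integral q.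
Proof.
rewrite /colatitude_integral -RintegralD //; try exact: integrable_horner_cos_sin.
by apply: eq_Rintegral => t _; rewrite hornerD mulrDl.
Qed.

Lemma colatitude_integralZ c p :
  colatitude_integral (c *: p) = c * colatitude_integral p.
Proof.
rewrite /colatitude_integral -RintegralZl //; last exact: integrable_horner_cos_sin.
by apply: eq_Rintegral => t _; rewrite hornerZ mulrA.
Qed.

Lemma colatitude_integral0 : colatitude_integral 0 = 0.
Proof. by rewrite -(scale0r 0) colatitude_integralZ mul0r. Qed.

(** [- p.[cos t]] is an antiderivative of the integrand, and the cosine takes the values 1 and -1 at
    the endpoints 0 and [pi]. *)
Lemma colatitude_integral_deriv p :
  colatitude_integral p^`() = p.[1] - p.[-1].
Proof.
have dF (t : R) : is_derive t (1 : R) (fun s => - p.[cos s]) (p^`().[cos t] * sin t).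
  have := is_deriveN (is_derive1_comp (is_derive_poly p (cos t)) (is_derive_cos t)).
  by rewrite mulrN opprK.
rewrite /colatitude_integral (Rintegral_derive _ _ dF) ?pi_gt0 //.
- by rewrite cospi cos0 opprK addrC.
- exact: continuous_horner_cos_sin.
Qed.

Lemma colatitude_integral_parts p q : root (p * q) 1 -> root (p * q) (-1) ->
  colatitude_integral (p^`() * q) = - colatitude_integral (p * q^`()).
Proof.
move=> /rootP r1 /rootP rN1; apply/eqP; rewrite -addr_eq0 -colatitude_integralD.
by rewrite -derivM colatitude_integral_deriv r1 rN1 subrr.
Qed.

Lemma dvdp_deriv_exp (w u : {poly R}) n :
  (w ^+ n.+1 %| u)%R -> (w ^+ n %| u^`())%R.
Proof.
move=> /dvdpP [v ->]; rewrite derivM deriv_exp /=; apply: dvdp_add.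
  by rewrite exprS; apply/dvdp_mull/dvdp_mull.
by rewrite -mulrnAl; apply/dvdp_mull/dvdp_mull.
Qed.

(** Each derivative costs at most one factor [w]. With w = X^2 - 1 this is what makes the boundary
    terms vanish in repeated integration by parts. *)
Lemma dvdp_derivn_exp (w u : {poly R}) k n :
  (w ^+ (n + k) %| u)%R -> (w ^+ n %| u^`(k))%R.
Proof.
elim: k n => [|k IH] n; first by rewrite addn0.
by rewrite addnS derivnS -addSn => /IH /dvdp_deriv_exp.
Qed.

Notation W := ('X ^+ 2 - 1 : {poly R}).

Lemma root_dvdp_W u x : x ^+ 2 = 1 -> (W %| u)%R -> root u x.
Proof.
move=> x1 /dvdpP [v ->]; rewrite rootM; apply/orP; right.
by rewrite /root !hornerE x1 subrr.
Qed.

(** Derivatives move from [u] to [v] one at a time. At every stage at least one factor X^2 - 1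
    survives in the differentiated [u], so nothing is contributed at 1 and -1. *)
Lemma colatitude_integral_parts_iter k u v : (W ^+ k %| u)%R ->
  colatitude_integral (u^`(k) * v) = (-1) ^+ k * colatitude_integral (u * v^`(k)).
Proof.
elim: k v => [|k IH] v Wu; first by rewrite !derivn0 expr0 mul1r.
have Wuk : (W %| u^`(k) * v)%R.
  by apply/dvdp_mulr; rewrite -[W]expr1; apply: dvdp_derivn_exp; rewrite add1n.
rewrite derivnS colatitude_integral_parts; try by apply: root_dvdp_W => //; rewrite ?expr1n ?sqrrN ?expr1n.
rewrite IH; last by apply: dvdp_trans Wu; rewrite [W ^+ k.+1]exprS dvdp_mull.
by rewrite -derivSn exprS mulN1r mulNr.
Qed.

Lemma size_legendre_le l : (size (legendre R l) <= l.+1)%N.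
Proof.
apply: (leq_trans (size_scale_leq _ _)).
rewrite cauchyreals.size_derivn; apply: leq_trans (leq_sub2r l (size_poly_exp_leq _ _)) _.
have -> : size W = 3 by rewrite -[1]/(1%:P) size_XnsubC.
by rewrite mul2n -addnn subSn ?leq_addl // addnK.
Qed.

(** This is the top coefficient: it comes from the leading 1 of the monic (X^2 - 1)^l, multiplied by
    falling factorials and by the Rodrigues constant. It certifies that the derivative is not the
    zero polynomial. *)
Lemma legendre_coef l m : (m <= l)%N -> ((legendre R l)^`(m))`_(l - m) != 0.
Proof.
move=> ml; rewrite /legendre derivnZ coefZ !coef_derivn subnKC // addnn.
have -> : (W ^+ l)`_(l.*2) = 1.
  have /monicP : W ^+ l \is monic by apply: monic_exp; rewrite -[1]/(1%:P) monicXnsubC.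
  rewrite lead_coefE size_exp -[1]/(1%:P) size_XnsubC //=; by rewrite mul2n.
rewrite mulf_neq0 ?invr_eq0 ?pnatr_eq0 //.
  by rewrite -lt0n muln_gt0 expn_gt0 fact_gt0.
rewrite -mulrnA pnatr_eq0 -lt0n muln_gt0 !ffact_gt0 -addnn leq_addr.
by rewrite ml.
Qed.

(** Moving the m derivatives off the degree-l factor leaves it against a polynomial [V] of degree at
    most l'. By Rodrigues' formula that factor is itself an l-th derivative, and moving these l
    derivatives onto [V] annihilates it since l' < l. *)
Lemma legendre_orthogonal_lt l l' m : (m <= l')%N -> (l' < l)%N ->
  colatitude_integral (W ^+ m * (legendre R l)^`(m) * (legendre R l')^`(m)) = 0.
Proof.
move=> ml' l'l; pose V := (W ^+ m * (legendre R l')^`(m))^`(m).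
(* The degree of [V] is at most 2m + (l' - m) - m = l'. *)
have sV : (size V <= l)%N.
  rewrite /V cauchyreals.size_derivn leq_subLR.
  apply: leq_trans (size_polyMleq _ _) _.
  rewrite cauchyreals.size_derivn.
  have sW : (size (W ^+ m) <= (m + m).+1)%N.
    apply: leq_trans (size_poly_exp_leq _ _) _.
    by rewrite -[1]/(1%:P) size_XnsubC // mul2n addnn.
  rewrite -subn1 leq_subLR.
  by apply: leq_trans (leq_add sW (leq_sub2r m (size_legendre_le l'))) _; lia.
have E1 : colatitude_integral (W ^+ m * (legendre R l)^`(m) * (legendre R l')^`(m))
    = (-1) ^+ m * colatitude_integral (legendre R l * V).
  apply: (@mulrI _ ((-1) ^+ m)); first by rewrite unitrX // unitrN1.
  rewrite mulrA -expr2 sqrr_sign mul1r.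
  rewrite mulrC -mulrA [X in _ = colatitude_integral X]mulrC.
  rewrite /V colatitude_integral_parts_iter ?dvdp_mulr //.
  by rewrite mulrC; congr (_ * colatitude_integral _); rewrite mulrAC mulrA.
rewrite E1 /legendre -scalerAl colatitude_integralZ colatitude_integral_parts_iter //.
have -> : V^`(l) = 0 by apply/eqP; rewrite -size_poly_eq0 cauchyreals.size_derivn subn_eq0.
by rewrite mulr0 colatitude_integral0 !mulr0.
Qed.

Lemma legendre_orthogonal l l' m : (m <= l)%N -> (m <= l')%N -> l != l' ->
  colatitude_integral (W ^+ m * (legendre R l)^`(m) * (legendre R l')^`(m)) = 0.
Proof.
move=> ml ml'; rewrite neq_ltn => /orP[ll'|l'l]; last exact: legendre_orthogonal_lt.
by rewrite mulrAC legendre_orthogonal_lt.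
Qed.

(** If the integral vanished, an antiderivative of [p] would be nondecreasing on [-1, 1] with equal
    end values, hence constant there. A polynomial constant on an interval is constant, so [p] would
    be 0. *)
Lemma colatitude_integral_neq0 p : p != 0 ->
  (forall x, -1 <= x <= 1 -> 0 <= p.[x]) -> colatitude_integral p != 0.
Proof.
(* The termwise antiderivative; at index 0 the division by zero gives 0, so the constant term is
   0. *)
move=> p0 pge0; pose F := \poly_(i < (size p).+1) (p`_i.-1 / i%:R).
have dF : F^`() = p.
  apply/polyP => i; rewrite coef_deriv coef_poly ltnS /=.
  case: ltnP => [_|/leq_sizeP -> //]; last by rewrite mul0rn.
  by rewrite -[LHS]mulr_natr divfK // pnatr_eq0.
rewrite -dF colatitude_integral_deriv subr_eq0; apply: contra p0 => /eqP F11.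
have mF : {in `[-1, 1] &, {homo horner F : x y / x <= y}}.
  apply: ger0_derive1_le_cc.
  - by move=> x _; exact: derivable_horner.
  - by move=> x; rewrite in_itv /= => /andP[/ltW x1 /ltW x2]; rewrite -derivE dF pge0 ?x1.
  - by apply: continuous_subspaceT; exact: continuous_horner.
(* The points 1/(i+1) are distinct and lie in [-1, 1]; taking as many as the size of the polynomial
   gives more roots than its degree allows. *)
pose s := [seq (i.+1%:R : R)^-1 | i <- iota 0 (size (F - F.[1]%:P))].
have : F - F.[1]%:P = 0.
  apply: (@roots_geq_poly_eq0 _ _ s).
  - apply/allP => _ /mapP[i _ ->]; rewrite /root !hornerE subr_eq0 eq_le.
    have i1 : (i.+1%:R : R)^-1 <= 1 by rewrite invf_le1 ?ler1n ?ltr0n.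
    have i0 : -1 <= (i.+1%:R : R)^-1 by rewrite (@le_trans _ _ 0) ?oppr_le0 ?invr_ge0.
    have i1' : (1 : R) \in `[-1, 1] by rewrite in_itv /= lexx andbT ge0_cp.
    rewrite mF // ?in_itv /= ?i0 ?i1 //=; rewrite F11 mF // ?in_itv /= ?i0 ?i1 ?lexx //.
    by rewrite (le_trans i0 i1).
  - rewrite map_inj_uniq ?iota_uniq // => i j /invr_inj /eqP.
    by rewrite eqr_nat eqSS => /eqP.
  - by rewrite size_map size_iota.
by move=> /eqP; rewrite subr_eq0 -dF => /eqP ->; rewrite derivC.
Qed.

(** The weight 1 - X^2 is nonnegative on [-1, 1] and the other factor is a square, so positivity
    applies once both factors are known to be non-zero. *)
Lemma legendre_norm_neq0 l m : (m <= l)%N ->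
  colatitude_integral ((1 - 'X ^+ 2) ^+ m * (legendre R l)^`(m) ^+ 2) != 0.
Proof.
move=> ml; apply: colatitude_integral_neq0.
  rewrite mulf_neq0 ?expf_neq0 //.
    by rewrite -oppr_eq0 opprB -size_poly_eq0 -[1]/(1%:P) size_XnsubC.
  by apply: contraNneq (legendre_coef ml) => ->; rewrite coef0.
move=> x /andP[x1 x2]; rewrite hornerM !horner_exp mulr_ge0 ?sqr_ge0 // exprn_ge0 //.
by rewrite !hornerE -(expr1n _ 2) subr_sqr mulr_ge0 ?subr_ge0 // -lerBlDl sub0r.
Qed.

(** The surface integral produces the weight sin^2 = 1 - cos^2, whereas Rodrigues' formula uses X^2
    - 1; the two differ by a sign raised to the power m. *)
Lemma legendre_orthogonal_onem l l' m : (m <= l)%N -> (m <= l')%N -> l != l' ->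
  colatitude_integral ((1 - 'X ^+ 2) ^+ m * (legendre R l)^`(m) * (legendre R l')^`(m)) = 0.
Proof.
move=> ml ml' ll'; rewrite -opprB -scaleN1r exprZn -!scalerAl colatitude_integralZ.
by rewrite legendre_orthogonal // mulr0.
Qed.

End polynomial_orthogonality.

(** * Integration in spherical coordinates *)

Section spherical_change_of_variables.
Variable R : realType.
Local Open Scope ereal_scope.
Local Notation mu2 := ((@lebesgue_measure R) \x (@lebesgue_measure R)).
Local Notation rect := (@sph_rect R).
Local Notation sph := (@sph_point R).

Import HBNNSimple.

Lemma measurable_sph_rect_full : measurable rect.
Proof. by apply: measurableX; exact: measurable_itv. Qed.

Lemma sin_ge0_sph_rect t : rect t -> 0 <= (@sin R t.1)%:E.
Proof. by move=> rt; apply: (@sin_sph_rect_ge0 _ setT); split. Qed.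

Lemma integral_indic_surface (A : set (sphere R)) : measurable A ->
  surface_measure A = \int[mu2]_(t in rect) ((\1_A (sph t))%:E * (sin t.1)%:E).
Proof.
move=> mA; rewrite /surface_measure /= /surface_measure integral_mkcondr.
apply: eq_integral => t _; rewrite patchE indicE /=.
have -> : (t \in sph @^-1` A) = (sph t \in A) by apply/idP/idP; rewrite !inE.
by case: ifP => _; rewrite ?mul1e ?mul0e.
Qed.

(** For indicators this is the definition of the surface measure. Linearity extends it to simple
    functions, and monotone convergence on both sides to nonnegative measurable ones. *)
Lemma ge0_integral_surface (f : sphere R -> \bar R) :
  measurable_fun setT f -> (forall x, 0 <= f x) ->
  \int[surface_measure]_x f x =
  \int[mu2]_(t in rect) (f (sph t) * (sin t.1)%:E).
Proof.
move=> mf f0; pose g := nnsfun_approx measurableT mf.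
have gf x : EFin \o g ^~ x @ \oo --> f x by apply: cvg_nnsfun_approx.
have mrect := measurable_sph_rect_full.
have msph D : measurable_fun D sph by apply: measurable_funTS; exact: measurable_sph_point.
have mg n : measurable_fun rect (fun t => (g n (sph t))%:E).
  by apply/measurable_EFinP; apply: measurableT_comp; [exact: measurable_funP|exact: msph].
transitivity (limn (fun n => \int[surface_measure]_x (g n x)%:E)).
  rewrite -monotone_convergence //.
  - by apply: eq_integral => x _; apply/esym/cvg_lim => //; exact: gf.
  - by move=> n; exact/measurable_EFinP/measurable_funP.
  - by move=> n x _; rewrite lee_fin.
  - by move=> x _ m n mn; rewrite lee_fin; exact/lefP/nd_nnsfun_approx.
have -> : (fun n => \int[surface_measure]_x (g n x)%:E) =
    fun n => \int[mu2]_(t in rect) ((g n (sph t))%:E * (sin t.1)%:E).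
  apply/funext => n; rewrite integralT_nnsfun sintegralE.
  transitivity (\int[mu2]_(t in rect) (\sum_(r \in range (g n))
     (r%:E * ((\1_(g n @^-1` [set r]) (sph t))%:E * (sin t.1)%:E)))); last first.
    apply: eq_integral => t rt; rewrite [in RHS]fimfunE -fsumEFin //.
    rewrite ge0_mule_fsuml; last by move=> r; rewrite EFinM nnfun_muleindic_ge0.
    by apply: eq_fsbigr => r _; rewrite EFinM muleA.
  have mind r : measurable_fun rect
      (fun t => (\1_(g n @^-1` [set r]) (sph t))%:E * (sin t.1)%:E).
    apply: emeasurable_funM; last exact: measurable_sin1.
    by apply/measurable_EFinP; apply: measurableT_comp; last exact: msph.
  rewrite ge0_integral_fsum //; last 2 first.
  - by move=> r; apply: measurable_funeM.
  - by move=> r t rt; rewrite muleA mule_ge0 ?nnfun_muleindic_ge0 ?sin_ge0_sph_rect.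
  (* A negative [r] is never attained by the nonnegative simple function, so both terms are 0. *)
  apply: eq_fsbigr => r _; have [r0|r0] := leP 0%R r.
    rewrite ge0_integralZl_EFin //; first by congr (_ * _); exact: integral_indic_surface.
    by move=> t rt; apply: mule_ge0; [rewrite lee_fin|exact: sin_ge0_sph_rect].
  rewrite preimage_nnfun0 // measure0 mule0 integral0_eq // => t _.
  by rewrite indic0 mul0e mule0.
rewrite -monotone_convergence //.
- apply: eq_integral => t /[!inE] rt; apply/cvg_lim => //.
  rewrite muleC; under eq_fun do rewrite muleC.
  by apply: cvgeZl => //; exact: gf.
- by move=> n; apply: emeasurable_funM => //; exact: measurable_sin1.
- by move=> n t rt; apply: mule_ge0; [rewrite lee_fin|exact: sin_ge0_sph_rect].
- move=> t rt m n mn; rewrite lee_wpmul2r ?sin_ge0_sph_rect // lee_fin.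
  exact/lefP/nd_nnsfun_approx.
Qed.

End spherical_change_of_variables.

Section product_integrals.
Context d1 d2 (T1 : measurableType d1) (T2 : measurableType d2) (R : realType).
Variable m1 : {sigma_finite_measure set T1 -> \bar R}.
Variable m2 : {sigma_finite_measure set T2 -> \bar R}.

(** Tonelli for the absolute values shows that the product is integrable; Fubini then pulls one
    factor out of each iterated integral. *)
Lemma Rintegral_prod_mul (a : T1 -> R) (b : T2 -> R) :
  m1.-integrable setT (EFin \o a) -> m2.-integrable setT (EFin \o b) ->
  \int[(m1 \x m2)%E]_z (a z.1 * b z.2) = \int[m1]_x a x * \int[m2]_y b y.
Proof.
move=> ia ib; rewrite /Rintegral.
have ma : measurable_fun setT a by exact/measurable_EFinP/(measurable_int m1).
have mb : measurable_fun setT b by exact/measurable_EFinP/(measurable_int m2).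
have mab : measurable_fun setT (fun z : T1 * T2 => (a z.1 * b z.2)%:E).
  by apply/measurable_EFinP/measurable_funM; apply: measurableT_comp.
rewrite -integral12_prod_meas1; last first.
  apply/(integrable12ltyP m1 m2 mab).
  have Eab x : (\int[m2]_y `|(a x * b y)%:E| = `|(a x)%:E| * \int[m2]_y `|(b y)%:E|)%E.
    rewrite -ge0_integralZl //; last by apply: measurableT_comp => //; exact/measurable_EFinP.
    by apply: eq_integral => y _; rewrite EFinM abseM.
  under eq_integral do rewrite Eab.
  have [_ a1] := integrableP _ _ _ ia; have [_ b1] := integrableP _ _ _ ib.
  rewrite ge0_integralZr //; last 2 first.
  - by apply: measurableT_comp => //; exact/measurable_EFinP.
  - exact: integral_ge0.
  have Ib0 : (0 <= \int[m2]_y `|(b y)%:E|)%E by exact: integral_ge0.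
  have Ia0 : (0 <= \int[m1]_y `|(a y)%:E|)%E by exact: integral_ge0.
  by rewrite -ge0_fin_numE ?mule_ge0 // fin_numM // ge0_fin_numE.
have Eab x : (\int[m2]_y ((a x * b y)%:E) = (a x)%:E * \int[m2]_y (b y)%:E)%E.
  by under eq_integral do rewrite EFinM; rewrite integralZl.
rewrite [in LHS](eq_integral (fun x => (a x)%:E * \int[m2]_y (b y)%:E)%E); last first.
  by move=> x _; exact: Eab.
have fb : (\int[m2]_y (b y)%:E)%E \is a fin_num by exact: integrable_fin_num.
have fa : (\int[m1]_y (a y)%:E)%E \is a fin_num by exact: integrable_fin_num.
by rewrite -{1}(fineK fb) integralZr // fineM ?fineK.
Qed.

End product_integrals.

Section surface_integrals.
Variable R : realType.
Local Notation mu := (@lebesgue_measure R).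
Local Notation rect := (@sph_rect R).
Local Notation sph := (@sph_point R).

(** Since [sin t.1] is nonnegative on the rectangle, multiplying by it commutes with taking positive
    and negative parts, which reduces to the nonnegative case. *)
Lemma Rintegral_surface (f : sphere R -> R) : measurable_fun setT f ->
  \int[surface_measure]_x f x =
  \int[(mu \x mu)%E]_(t in rect) (f (sph t) * sin t.1).
Proof.
move=> mf; rewrite /Rintegral; congr fine.
rewrite integralE [RHS]integralE; congr (_ - _)%E.
- rewrite ge0_integral_surface //; last by apply: measurable_funepos; exact/measurable_EFinP.
  apply: eq_integral => t /[!inE] rt; rewrite !funeposE EFinM maxe_pMl ?mul0e //.
  exact: sin_ge0_sph_rect.
- rewrite ge0_integral_surface //; last by apply: measurable_funeneg; exact/measurable_EFinP.
  apply: eq_integral => t /[!inE] rt; rewrite !funenegE EFinM maxe_pMl ?mul0e ?muleN ?mulNe //.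
  exact: sin_ge0_sph_rect.
Qed.

Lemma Rintegral_surface_mul (f : sphere R -> R) (A B : R -> R) :
  measurable_fun setT f -> continuous A -> continuous B ->
  (forall t, f (sph t) = A t.1 * B t.2) ->
  \int[surface_measure]_x f x =
  \int[mu]_(t in `[0, pi]) (A t * sin t) * \int[mu]_(t in `[0, pi *+ 2]) B t.
Proof.
move=> mf cA cB fE; rewrite Rintegral_surface //.
have cAs : continuous (fun t : R => A t * sin t).
  by move=> t; apply: cvgM; [exact: cA|exact: continuous_sin].
have int_cont (g : R -> R) a b : continuous g ->
    mu.-integrable setT (EFin \o (g \_ `[a, b]) : measurableTypeR R -> \bar R).
  move=> cg; have mI : measurable (`[a, b]%classic : set (measurableTypeR R)) by exact: measurable_itv.
  rewrite -restrict_EFin; apply/(integrable_mkcond _ mI).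
  apply: continuous_compact_integrable; first exact: segment_compact.
  exact: continuous_subspaceT.
rewrite [LHS]Rintegral_mkcond [X in _ = X * _]Rintegral_mkcond [X in _ = _ * X]Rintegral_mkcond.
rewrite -Rintegral_prod_mul; try exact: int_cont.
apply: eq_Rintegral => -[x y] _; rewrite !patchE /= fE /=.
rewrite /rect in_setX /=.
(* Outside its domain a restricted function takes the default value [point], which is 0 in [R];
   hence restricting the product to the rectangle is the same as restricting each factor to its
   interval. *)
rewrite -[point]/(0 : R).
by do 2 case: (_ \in _) => //=; rewrite ?mulr0 ?mul0r // mulrAC.
Qed.

End surface_integrals.

(** * Spherical harmonics *)

Section complex_parts.
Variable R : realType.
Implicit Types z w : R[i].

Lemma Re_add z w : complex.Re (z + w) = complex.Re z + complex.Re w.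
Proof. by case: z => a b; case: w. Qed.

Lemma Im_add z w : complex.Im (z + w) = complex.Im z + complex.Im w.
Proof. by case: z => a b; case: w. Qed.

Lemma Re_opp z : complex.Re (- z) = - complex.Re z.
Proof. by case: z. Qed.

Lemma Im_opp z : complex.Im (- z) = - complex.Im z.
Proof. by case: z. Qed.

Lemma Re_mul z w : complex.Re (z * w) =
  complex.Re z * complex.Re w - complex.Im z * complex.Im w.
Proof. by case: z => a b; case: w. Qed.

Lemma Im_mul z w : complex.Im (z * w) =
  complex.Re z * complex.Im w + complex.Im z * complex.Re w.
Proof. by case: z => a b; case: w. Qed.

Lemma Re_conjc z : complex.Re z^* = complex.Re z.
Proof. by case: z. Qed.

Lemma Im_conjc z : complex.Im z^* = - complex.Im z.
Proof. by case: z. Qed.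

Lemma Re_sum I (r : seq I) (Q : pred I) (F : I -> R[i]) :
  complex.Re (\sum_(i <- r | Q i) F i) = \sum_(i <- r | Q i) complex.Re (F i).
Proof. by apply: (big_morph _ Re_add). Qed.

Lemma Im_sum I (r : seq I) (Q : pred I) (F : I -> R[i]) :
  complex.Im (\sum_(i <- r | Q i) F i) = \sum_(i <- r | Q i) complex.Im (F i).
Proof. by apply: (big_morph _ Im_add). Qed.

Lemma normc2 z : Normc.normc z ^+ 2 = complex.Re z ^+ 2 + complex.Im z ^+ 2.
Proof. by case: z => a b; rewrite /= sqr_sqrtr // addr_ge0 ?sqr_ge0. Qed.

(* In [Defs], [_^*] below a ring operation is parsed as [Num.conj]. *)
Lemma conj_conjc z : (z^*)%R = z^*.
Proof. by []. Qed.

Lemma realCM (a b : R) : (a * b)%:C = a%:C * b%:C :> R[i].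
Proof. exact: (rmorphM (@real_complex R)). Qed.

Lemma realCX (a : R) n : (a ^+ n)%:C = a%:C ^+ n :> R[i].
Proof. exact: (rmorphXn (@real_complex R)). Qed.

Lemma complex_eq z w : complex.Re z = complex.Re w -> complex.Im z = complex.Im w -> z = w.
Proof. by case: z => a b; case: w => c e /= -> ->. Qed.

Lemma conjc_realM (a : R) z : (a%:C * z)^* = a%:C * z^*.
Proof. by case: z => b c; apply: complex_eq; rewrite /= !mul0r ?addr0 ?subr0 ?mulrN ?oppr0 ?addr0. Qed.

End complex_parts.

(** * Bounded measurable functions, real and complex *)

Section bounded_measurable.
Context d (T : measurableType d) (R : realType).
Implicit Types f g : T -> R.

(** Such functions form an algebra and multiply integrable functions into integrable ones, so
    integrability of products with spherical harmonics follows from closure properties. *)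
Definition bmeas f := measurable_fun setT f /\ exists M, forall x, `|f x| <= M.

Lemma bmeas_cst (c : R) : bmeas (fun=> c).
Proof. by split; [exact: measurable_cst|exists `|c|]. Qed.

Lemma bmeasD f g : bmeas f -> bmeas g -> bmeas (fun x => f x + g x).
Proof.
move=> [mf [M fM]] [mg [N gN]]; split; first exact: measurable_funD.
by exists (M + N) => x; apply: le_trans (ler_normD _ _) _; exact: lerD.
Qed.

Lemma bmeasM f g : bmeas f -> bmeas g -> bmeas (fun x => f x * g x).
Proof.
move=> [mf [M fM]] [mg [N gN]]; split; first exact: measurable_funM.
by exists (M * N) => x; rewrite normrM ler_pM.
Qed.

Lemma bmeasN f : bmeas f -> bmeas (fun x => - f x).
Proof.
move=> bf; rewrite (_ : (fun x => _) = fun x => (-1) * f x).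
  exact: bmeasM (bmeas_cst _) bf.
by apply/funext => x; rewrite mulN1r.
Qed.

Lemma bmeas_horner f (p : {poly R}) : bmeas f -> bmeas (fun x => p.[f x]).
Proof.
move=> bf; elim/poly_ind: p => [|p c IH].
  rewrite (_ : (fun x => _) = cst 0); first exact: bmeas_cst.
  by apply/funext => x; rewrite horner0.
rewrite (_ : (fun x => _) = fun x => p.[f x] * f x + c).
  exact: bmeasD (bmeasM IH bf) (bmeas_cst _).
by apply/funext => x; rewrite hornerMXaddC.
Qed.

Definition cbmeas (f : T -> R[i]) :=
  bmeas (fun x => complex.Re (f x)) /\ bmeas (fun x => complex.Im (f x)).

Implicit Types u v : T -> R[i].

Lemma cbmeasM u v : cbmeas u -> cbmeas v -> cbmeas (fun x => u x * v x).
Proof.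
move=> [ru iu] [rv iv]; split.
- under eq_fun do rewrite Re_mul.
  exact: bmeasD (bmeasM ru rv) (bmeasN (bmeasM iu iv)).
- under eq_fun do rewrite Im_mul.
  exact: bmeasD (bmeasM ru iv) (bmeasM iu rv).
Qed.

Lemma cbmeasD u v : cbmeas u -> cbmeas v -> cbmeas (fun x => u x + v x).
Proof.
move=> [ru iu] [rv iv]; split.
- by under eq_fun do rewrite Re_add; exact: bmeasD.
- by under eq_fun do rewrite Im_add; exact: bmeasD.
Qed.

Lemma cbmeas_conj u : cbmeas u -> cbmeas (fun x => (u x)^*).
Proof.
move=> [ru iu]; split.
- by under eq_fun do rewrite Re_conjc.
- by under eq_fun do rewrite Im_conjc; exact: bmeasN.
Qed.

Lemma cbmeas_real f : bmeas f -> cbmeas (fun x => (f x)%:C).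
Proof. by move=> bf; split => //=; exact: bmeas_cst. Qed.

Lemma cbmeas_cst (c : R[i]) : cbmeas (fun=> c).
Proof. by split; exact: bmeas_cst. Qed.

Lemma cbmeas_sum I (r : seq I) (F : I -> T -> R[i]) :
  (forall i, cbmeas (F i)) -> cbmeas (fun x => \sum_(i <- r) F i x).
Proof.
move=> bF; elim: r => [|i r IH].
  by under eq_fun do rewrite big_nil; exact: cbmeas_cst.
by under eq_fun do rewrite big_cons; exact: cbmeasD.
Qed.

Lemma cbmeasX u n : cbmeas u -> cbmeas (fun x => u x ^+ n).
Proof.
move=> bu; elim: n => [|n IH].
  by under eq_fun do rewrite expr0; exact: cbmeas_cst.
by under eq_fun do rewrite exprS; exact: cbmeasM.
Qed.

End bounded_measurable.

Section spherical_harmonics_lemmas.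
Variable R : realType.
Local Notation mu := (@lebesgue_measure R).
Local Notation sph := (@sph_point R).

Lemma bmeas_coord (i : 'I_3) : bmeas (fun x : sphere R => set_val x ord0 i).
Proof.
split.
  have cc : continuous (fun x : sphere R => set_val x ord0 i).
    move=> x; apply: (@continuous_comp _ _ _ (set_val : sphere R -> _) (fun M : 'rV[R]_3 => M ord0 i)).
      exact: initial_continuous.
    exact: coord_continuous.
  apply: (measurability _ (RGenOpens.measurableE R)) => _ [_ [a [b ->] <-]].
  rewrite setTI; apply: sub_sigma_algebra.
  by move/continuousP : cc; apply; exact: interval_open.
exists 1 => x; have : \sum_(j < 3) (set_val x) ord0 j ^+ 2 = 1 := set_valP x.
move=> x1; rewrite -(@expr_le1 R 2) ?normr_ge0 // real_normK ?num_real // -x1.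
by rewrite (bigD1 i) //= lerDl sumr_ge0 // => j _; rewrite sqr_ge0.
Qed.

Lemma cbmeas_Ylm l (i : 'I_(l.*2.+1)) : cbmeas (@Ylm R l i).
Proof.
have bn m : cbmeas (@sph_harm_nneg R l m).
  apply: cbmeasM.
    apply: cbmeas_real; apply: bmeasM; first exact: bmeas_cst.
    by apply: bmeas_horner; exact: bmeas_coord.
  by apply: cbmeasX; split; exact: bmeas_coord.
rewrite /Ylm /sph_harm; case: (0 <= order_of i); first exact: bn.
by apply: cbmeasM; [exact: cbmeas_cst|apply: cbmeas_conj].
Qed.

(** The complex exponential e^(i t). *)
Definition cis (t : R) : R[i] := cos t +i* sin t.

Lemma cisD (s t : R) : cis (s + t) = cis s * cis t.
Proof. by apply: complex_eq; rewrite /= ?cosD ?sinD // addrC. Qed.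

Lemma cisN t : cis (- t) = (cis t)^*.
Proof. by rewrite /cis cosN sinN. Qed.

Lemma cisX t n : cis t ^+ n = cis (n%:R * t).
Proof.
elim: n => [|n IH]; first by rewrite mul0r /cis cos0 sin0.
by rewrite exprS IH -cisD -[in RHS]natr1 mulrDl mul1r addrC.
Qed.

(** In spherical coordinates x_0 + i x_1 = sin(theta) e^(i phi), whose |m|-th power separates the
    variables. Conjugation for negative orders turns |m| into the signed order in the
    exponential. *)
Lemma Ylm_spherical l (i : 'I_(l.*2.+1)) : exists2 c : R, c != 0 &
  forall t, Ylm i (sph t) =
    (c * (legendre R l)^`(`|order_of i|).[cos t.1] * sin t.1 ^+ `|order_of i|)%:C
    * cis ((order_of i)%:~R * t.2).
Proof.
set m := order_of i; set n := `|m|%N.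
pose k : R := Num.sqrt ((2 * l + 1)%:R / (4 * pi) * (l - n)`!%:R / (l + n)`!%:R).
have k0 : k != 0.
  have pi4 : 0 < 4 * pi :> R by rewrite mulr_gt0 // pi_gt0.
  by rewrite gt_eqF // sqrtr_gt0 !divr_gt0 ?mulr_gt0 ?invr_gt0 ?ltr0n ?fact_gt0 // addn1.
have nnegE t : sph_harm_nneg l n (sph t) =
    ((-1) ^+ n * k * (legendre R l)^`(n).[cos t.1] * sin t.1 ^+ n)%:C * cis (n%:R * t.2).
  rewrite /sph_harm_nneg /sph /= !set_valE /= !mxE !inordK //=.
  have -> : (sin t.1 * cos t.2 +i* (sin t.1 * sin t.2)) = (sin t.1)%:C * cis t.2.
    by apply: complex_eq; rewrite /= ?mul0r ?subr0 ?addr0.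
  by rewrite exprMn cisX mulrA -realCX -realCM.
(* For negative orders the sign in [sph_harm] cancels the Condon-Shortley phase. *)
exists (if 0 <= m then (-1) ^+ n * k else k).
  by case: ifP => _ //; rewrite mulf_neq0 // signr_eq0.
move=> t; rewrite /Ylm /sph_harm -/m -/n; case: ifPn => m0.
  by rewrite nnegE /n natr_absz (ger0_norm m0).
rewrite nnegE conj_conjc conjc_realM.
have -> : m%:~R = - (n%:R : R).
  by rewrite /n natr_absz ltr0_norm ?ltNge // mulrNz opprK.
rewrite mulNr cisN mulrA; congr (_ * _).
rewrite -[X in X * _](rmorph_sign (@real_complex R)) -realCM !mulrA -expr2 sqrr_sign.
by rewrite mul1r.
Qed.

End spherical_harmonics_lemmas.

(** * Orthogonality of the spherical harmonics *)

Section orthogonality.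
Variable R : realType.
Local Notation mu := (@lebesgue_measure R).
Local Notation sph := (@sph_point R).

Lemma sin_int_2pi (k : int) : sin (k%:~R * (pi *+ 2) : R) = 0.
Proof.
have H n : sin (n%:R * (pi *+ 2) : R) = 0.
  by rewrite mulr_natl -[_ *+ n]add0r (periodicn (@sinD2pi R)) sin0.
by case: k => n; [exact: H|rewrite NegzE mulrNz mulNr sinN H oppr0].
Qed.

Lemma cos_int_2pi (k : int) : cos (k%:~R * (pi *+ 2) : R) = 1.
Proof.
have H n : cos (n%:R * (pi *+ 2) : R) = 1.
  by rewrite mulr_natl -[_ *+ n]add0r (periodicn (@cosD2pi R)) cos0.
by case: k => n; [exact: H|rewrite NegzE mulrNz mulNr cosN H].
Qed.

Lemma pi2_gt0 : 0 < pi *+ 2 :> R.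
Proof. by rewrite pmulrn_rgt0 // pi_gt0. Qed.

Lemma is_derive_scale (a t : R) : is_derive t (1 : R) (fun s : R => a * s) a.
Proof.
apply: is_derive_eq.
by rewrite /GRing.scale /= mulr1.
Qed.

Lemma continuous_cos_scale (a : R) : continuous (fun t : R => cos (a * t)).
Proof.
move=> t; apply: (@continuous_comp _ _ _ (fun t => a * t) (@cos R)); first exact: mulrl_continuous.
exact: continuous_cos.
Qed.

Lemma continuous_sin_scale (a : R) : continuous (fun t : R => sin (a * t)).
Proof.
move=> t; apply: (@continuous_comp _ _ _ (fun t => a * t) (@sin R)); first exact: mulrl_continuous.
exact: continuous_sin.
Qed.

Lemma Rintegral_cos_int (k : int) : k != 0 ->
  \int[mu]_(t in `[0, pi *+ 2]) cos (k%:~R * t) = 0.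
Proof.
move=> k0; have kR0 : k%:~R != 0 :> R by rewrite intr_eq0.
have dF (t : R) : is_derive t (1 : R) (fun s : R => k%:~R^-1 * sin (k%:~R * s)) (cos (k%:~R * t)).
  have := is_derive1_comp (is_derive_scale k%:~R^-1 (sin (k%:~R * t)))
    (is_derive1_comp (is_derive_sin (k%:~R * t)) (is_derive_scale k%:~R t)).
  by rewrite mulrCA mulVf // mulr1.
rewrite (Rintegral_derive pi2_gt0 _ dF); last exact: continuous_cos_scale.
by rewrite sin_int_2pi !mulr0 sin0 mulr0 subrr.
Qed.

Lemma Rintegral_sin_int (k : int) :
  \int[mu]_(t in `[0, pi *+ 2]) sin (k%:~R * t) = 0.
Proof.
have [->|k0] := eqVneq k 0.
  rewrite (@eq_Rintegral _ _ _ _ _ (cst 0)); last by move=> t _; rewrite mul0r sin0.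
  by rewrite Rintegral_cst ?mul0r.
have kR0 : k%:~R != 0 :> R by rewrite intr_eq0.
have dF (t : R) : is_derive t (1 : R) (fun s : R => - k%:~R^-1 * cos (k%:~R * s)) (sin (k%:~R * t)).
  have := is_derive1_comp (is_derive_scale (- k%:~R^-1) (cos (k%:~R * t)))
    (is_derive1_comp (is_derive_cos (k%:~R * t)) (is_derive_scale k%:~R t)).
  by rewrite mulNr mulNr mulrN opprK mulrCA mulVf // mulr1.
rewrite (Rintegral_derive pi2_gt0 _ dF); last exact: continuous_sin_scale.
by rewrite cos_int_2pi mulr0 cos0 subrr.
Qed.

Section pair.
Variables (l l' : nat) (i : 'I_(l.*2.+1)) (j : 'I_(l'.*2.+1)).

Lemma order_of_le : (`|order_of i| <= l)%N.
Proof. by rewrite /order_of; have := ltn_ord i; lia. Qed.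

Lemma Ylm_product : exists2 c : R, c != 0 &
  forall t, (Ylm i (sph t))^* * Ylm j (sph t) =
    (c * ((legendre R l)^`(`|order_of i|) * (legendre R l')^`(`|order_of j|)).[cos t.1]
       * sin t.1 ^+ (`|order_of i| + `|order_of j|))%:C
    * cis ((order_of j - order_of i)%:~R * t.2).
Proof.
have [a a0 Ei] := Ylm_spherical R i; have [b b0 Ej] := Ylm_spherical R j.
exists (a * b); first exact: mulf_neq0.
move=> t; rewrite Ei Ej conj_conjc conjc_realM conj_conjc -cisN mulrACA -realCM -cisD.
congr (_%:C * cis _); first by rewrite hornerM exprD; ring.
by rewrite mulrzBr mulrBl addrC.
Qed.

Definition sphere_poly_fun c (m : nat) (p : {poly R}) (t : R) : R := c * p.[cos t] * sin t ^+ m.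

Lemma continuous_sphere_poly_fun c m p : continuous (sphere_poly_fun c m p).
Proof.
move=> t; apply: cvgM.
  apply: cvgM; first exact: cvg_cst.
  apply: (@continuous_comp _ _ _ cos (horner p)); first exact: continuous_cos.
  exact: continuous_horner.
apply: (@continuous_comp _ _ _ sin (fun x : R => x ^+ m)); first exact: continuous_sin.
exact: exprn_continuous.
Qed.

Let cb : cbmeas (fun x : sphere R => (Ylm i x)^* * Ylm j x).
Proof. by apply: cbmeasM; [apply: cbmeas_conj|]; exact: cbmeas_Ylm. Qed.

Lemma Re_Ylm_product_integral : exists2 c : R, c != 0 &
  \int[@surface_measure R]_x complex.Re ((Ylm i x)^* * Ylm j x) =
  (\int[mu]_(t in `[0, pi]) (sphere_poly_fun c (`|order_of i| + `|order_of j|)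
     ((legendre R l)^`(`|order_of i|) * (legendre R l')^`(`|order_of j|)) t * sin t))
  * \int[mu]_(t in `[0, pi *+ 2]) cos ((order_of j - order_of i)%:~R * t).
Proof.
have [c c0 E] := Ylm_product; exists c => //.
apply: Rintegral_surface_mul.
- by case: cb => -[].
- exact: continuous_sphere_poly_fun.
- exact: continuous_cos_scale.
- by move=> t; rewrite E Re_mul /= mul0r subr0.
Qed.

(** The longitude factor is the sine of an integer multiple of the angle, which integrates to 0 over
    a full period for every integer, including 0. *)
Lemma Im_Ylm_product_integral :
  \int[@surface_measure R]_x complex.Im ((Ylm i x)^* * Ylm j x) = 0.
Proof.
have [c c0 E] := Ylm_product.
rewrite (@Rintegral_surface_mul _ _ (sphere_poly_fun c (`|order_of i| + `|order_of j|)
     ((legendre R l)^`(`|order_of i|) * (legendre R l')^`(`|order_of j|)))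
   (fun t => sin ((order_of j - order_of i)%:~R * t))).
- by rewrite Rintegral_sin_int mulr0.
- by case: cb => _ [].
- exact: continuous_sphere_poly_fun.
- exact: continuous_sin_scale.
- by move=> t; rewrite E Im_mul /= mul0r addr0.
Qed.

Lemma colatitude_sphere_poly_fun c m p :
  \int[mu]_(t in `[0, pi]) (sphere_poly_fun c (m + m) p t * sin t) =
  c * colatitude_integral ((1 - 'X ^+ 2) ^+ m * p).
Proof.
rewrite /colatitude_integral -RintegralZl //; last exact: integrable_horner_cos_sin.
apply: eq_Rintegral => t _; rewrite /sphere_poly_fun hornerM horner_exp.
have -> : (1 - 'X ^+ 2).[cos t] = 1 - cos t ^+ 2 by rewrite !hornerE.
by rewrite -sin2cos2 addnn -muln2 mulnC exprM; ring.
Qed.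

Lemma Ylm_orthogonal : l != l' \/ order_of i != order_of j ->
  cintegral (@surface_measure R) setT (fun x => (Ylm i x)^* * Ylm j x) = 0.
Proof.
move=> H; apply: complex_eq; rewrite /= ?Im_Ylm_product_integral //.
have [c c0 ->] := Re_Ylm_product_integral.
have [Eij|/eqP Nij] := eqVneq (order_of i) (order_of j); last first.
  by rewrite Rintegral_cos_int ?mulr0 // subr_eq0 eq_sym; apply/eqP.
(* With equal orders the degrees must differ, and both harmonics involve Legendre derivatives of the
   same order, so Legendre orthogonality applies. *)
have {H} ll' : l != l' by case: H => //; rewrite Eij eqxx.
have := order_of_le; rewrite Eij colatitude_sphere_poly_fun => jl.
rewrite mulrA legendre_orthogonal_onem ?mulr0 ?mul0r //.
by rewrite /order_of; have := ltn_ord j; lia.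
Qed.

End pair.

(** Kept as an unevaluated constant: orthogonality together with its non-vanishing takes the place
    of orthonormality below. *)
Definition Ylm_norm2 l (i : 'I_(l.*2.+1)) : R :=
  \int[@surface_measure R]_x (Normc.normc (Ylm i x) ^+ 2).

Lemma Ylm_norm2E l (i : 'I_(l.*2.+1)) :
  cintegral (@surface_measure R) setT (fun x => (Ylm i x)^* * Ylm i x) = (Ylm_norm2 i)%:C.
Proof.
apply: complex_eq; rewrite /= ?Im_Ylm_product_integral //.
apply: eq_Rintegral => x _; rewrite conj_conjc Re_mul Re_conjc Im_conjc normc2.
by rewrite mulNr opprK !expr2.
Qed.

(** On the diagonal the longitude integrand is the constant 1, giving 2 pi, and the colatitude
    integral is that of a non-zero polynomial nonnegative on [-1, 1]. *)
Lemma Ylm_norm2_neq0 l (i : 'I_(l.*2.+1)) : Ylm_norm2 i != 0.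
Proof.
have -> : Ylm_norm2 i = complex.Re (Ylm_norm2 i)%:C by [].
rewrite -Ylm_norm2E /=; have [c c0 ->] := Re_Ylm_product_integral i i.
rewrite colatitude_sphere_poly_fun -expr2 !mulf_neq0 ?legendre_norm_neq0 ?order_of_le //.
rewrite subrr (@eq_Rintegral _ _ _ _ _ (cst 1)); last by move=> t _; rewrite mul0r cos0.
rewrite Rintegral_cst //= lebesgue_measure_itv /= lte_fin pi2_gt0 /= oppr0 addr0 mul1r.
by rewrite gt_eqF // pi2_gt0.
Qed.

End orthogonality.

(** * Finite spherical harmonic expansions *)

Section complex_integral.
Context d (T : measurableType d) (R : realType) (mu : {measure set T -> \bar R}).
Variables (D : set T) (mD : measurable D).
Implicit Types u v : T -> R[i].

Lemma integrable_bmeasM (h g : T -> R) : bmeas h ->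
  mu.-integrable D (EFin \o g) -> mu.-integrable D (EFin \o (fun x => h x * g x)).
Proof.
move=> [mh [M hM]] ig.
apply: (integrableMr mD _ _ ig); first exact: measurable_funTS.
exists M; split; first exact: num_real.
by move=> N MN x _; exact: le_trans (hM x) (ltW MN).
Qed.

Lemma integrableD_real (f g : T -> R) : mu.-integrable D (EFin \o f) ->
  mu.-integrable D (EFin \o g) -> mu.-integrable D (EFin \o (fun x => f x + g x)).
Proof. by move=> jf jg; have := integrableD mD jf jg; apply: eq_integrable. Qed.

Lemma integrableB_real (f g : T -> R) : mu.-integrable D (EFin \o f) ->
  mu.-integrable D (EFin \o g) -> mu.-integrable D (EFin \o (fun x => f x - g x)).
Proof. by move=> jf jg; have := integrableB mD jf jg; apply: eq_integrable. Qed.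

Definition cintegrable u :=
  mu.-integrable D (EFin \o (fun x => complex.Re (u x))) /\
  mu.-integrable D (EFin \o (fun x => complex.Im (u x))).

Lemma cintegrableM u v : cbmeas u -> cintegrable v -> cintegrable (fun x => u x * v x).
Proof.
move=> [ru iu] [rv iv]; split.
- rewrite (_ : (fun x => _) = fun x =>
    complex.Re (u x) * complex.Re (v x) - complex.Im (u x) * complex.Im (v x)).
    exact: integrableB_real (integrable_bmeasM ru rv) (integrable_bmeasM iu iv).
  by apply/funext => x; rewrite Re_mul.
- rewrite (_ : (fun x => _) = fun x =>
    complex.Re (u x) * complex.Im (v x) + complex.Im (u x) * complex.Re (v x)).
    exact: integrableD_real (integrable_bmeasM ru iv) (integrable_bmeasM iu rv).
  by apply/funext => x; rewrite Im_mul.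
Qed.

Lemma cintegrableD u v : cintegrable u -> cintegrable v -> cintegrable (fun x => u x + v x).
Proof.
move=> [ru iu] [rv iv]; split.
- rewrite (_ : (fun x => _) = fun x => complex.Re (u x) + complex.Re (v x)).
    exact: integrableD_real.
  by apply/funext => x; rewrite Re_add.
- rewrite (_ : (fun x => _) = fun x => complex.Im (u x) + complex.Im (v x)).
    exact: integrableD_real.
  by apply/funext => x; rewrite Im_add.
Qed.

Lemma cintegrableB u v : cintegrable u -> cintegrable v -> cintegrable (fun x => u x - v x).
Proof.
move=> [ru iu] [rv iv]; split.
- rewrite (_ : (fun x => _) = fun x => complex.Re (u x) - complex.Re (v x)).
    exact: integrableB_real.
  by apply/funext => x; rewrite Re_add Re_opp.
- rewrite (_ : (fun x => _) = fun x => complex.Im (u x) - complex.Im (v x)).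
    exact: integrableB_real.
  by apply/funext => x; rewrite Im_add Im_opp.
Qed.

Lemma cintegralD u v : cintegrable u -> cintegrable v ->
  cintegral mu D (fun x => u x + v x) = cintegral mu D u + cintegral mu D v.
Proof.
move=> [ru iu] [rv iv]; apply: complex_eq => /=.
- by rewrite -RintegralD //; apply: eq_Rintegral => x _; rewrite Re_add.
- by rewrite -RintegralD //; apply: eq_Rintegral => x _; rewrite Im_add.
Qed.

Lemma cintegralB u v : cintegrable u -> cintegrable v ->
  cintegral mu D (fun x => u x - v x) = cintegral mu D u - cintegral mu D v.
Proof.
move=> [ru iu] [rv iv]; apply: complex_eq; rewrite ?Re_add ?Im_add ?Re_opp ?Im_opp /=.
- by rewrite -RintegralB //; apply: eq_Rintegral => x _; rewrite Re_add Re_opp.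
- by rewrite -RintegralB //; apply: eq_Rintegral => x _; rewrite Im_add Im_opp.
Qed.

Lemma cintegralZ c u : cintegrable u ->
  cintegral mu D (fun x => c * u x) = c * cintegral mu D u.
Proof.
move=> [ru iu]; apply: complex_eq; rewrite ?Re_mul ?Im_mul /=.
- rewrite -(RintegralZl _ mD ru) -(RintegralZl _ mD iu) -RintegralB //; last 2 first.
  + exact: integrable_bmeasM (bmeas_cst _ _) ru.
  + exact: integrable_bmeasM (bmeas_cst _ _) iu.
  by apply: eq_Rintegral => x _; rewrite Re_mul.
- rewrite -(RintegralZl _ mD ru) -(RintegralZl _ mD iu) -RintegralD //; last 2 first.
  + exact: integrable_bmeasM (bmeas_cst _ _) iu.
  + exact: integrable_bmeasM (bmeas_cst _ _) ru.
  by apply: eq_Rintegral => x _; rewrite Im_mul.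
Qed.

Lemma cintegral0 : cintegral mu D (fun=> 0 : R[i]) = 0.
Proof. by apply: complex_eq; rewrite /= Rintegral_cst // mul0r. Qed.

Lemma cintegrable0 : cintegrable (fun=> 0).
Proof. by split; exact: integrable0. Qed.

Lemma cintegrable_sum I (r : seq I) (F : I -> T -> R[i]) :
  (forall i, cintegrable (F i)) -> cintegrable (fun x => \sum_(i <- r) F i x).
Proof.
move=> iF; elim: r => [|i r IH].
  by under eq_fun do rewrite big_nil; exact: cintegrable0.
by under eq_fun do rewrite big_cons; exact: cintegrableD.
Qed.

Lemma cintegral_sum I (r : seq I) (F : I -> T -> R[i]) :
  (forall i, cintegrable (F i)) ->
  cintegral mu D (fun x => \sum_(i <- r) F i x) = \sum_(i <- r) cintegral mu D (F i).
Proof.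
move=> iF; elim: r => [|i r IH].
  by rewrite big_nil; under eq_fun do rewrite big_nil; exact: cintegral0.
rewrite big_cons -IH -cintegralD //; last exact: cintegrable_sum.
by congr cintegral; apply/funext => x; rewrite big_cons.
Qed.

Lemma cintegrable_cbmeas u : (mu D < +oo)%E -> cbmeas u -> cintegrable u.
Proof.
have bi f : (mu D < +oo)%E -> bmeas f -> mu.-integrable D (EFin \o f).
  move=> muD [mf [M fM]]; apply: measurable_bounded_integrable => //.
    exact: measurable_funTS.
  exists M; split; first exact: num_real.
  by move=> N MN x _; exact: le_trans (fM x) (ltW MN).
by move=> muD [? ?]; split; exact: bi.
Qed.

End complex_integral.

(** * Finite harmonic sums: Fourier coefficients, Parseval and Bessel *)

Section finite_expansions.
Variable R : realType.
Local Notation sigma := (@surface_measure R).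
Implicit Type a : coefs R.

(** The section of [field_trunc] at a fixed outcome. *)
Definition harmonic_sum a (L : nat) (x : sphere R) : R[i] :=
  \sum_(l < L.+1) \sum_(i < l.*2.+1) a l i ord0 * Ylm i x.

Lemma cbmeas_harmonic_sum a L : cbmeas (harmonic_sum a L).
Proof.
apply: cbmeas_sum => l; apply: cbmeas_sum => i.
by apply: cbmeasM; [exact: cbmeas_cst|exact: cbmeas_Ylm].
Qed.

Lemma surface_measure_ltoo (D : set (sphere R)) : measurable D -> (sigma D < +oo)%E.
Proof. by move=> mD; rewrite ltey_eq fin_num_measure. Qed.

Section domain.
Variables (D : set (sphere R)) (mD : measurable D).

Lemma cintegrable_surface u : cbmeas u -> cintegrable sigma D u.
Proof. by apply: cintegrable_cbmeas => //; exact: surface_measure_ltoo. Qed.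

(** The right-hand side has the shape of the terms of the constraint: taking for [v] the harmonic
    sum itself yields the quadratic term, and taking the observed field yields the linear one. *)
Lemma cintegral_harmonic_suml a L (v : sphere R -> R[i]) : cintegrable sigma D v ->
  cintegral sigma D (fun x => (harmonic_sum a L x)^* * v x) =
  \sum_(l < L.+1) hdot (a l) (\col_i cintegral sigma D (fun x => (Ylm i x)^* * v x)).
Proof.
move=> iv.
have iYv l (i : 'I_(l.*2.+1)) : cintegrable sigma D (fun x => (Ylm i x)^* * v x).
  by apply: cintegrableM => //; apply: cbmeas_conj; exact: cbmeas_Ylm.
have iaYv l (i : 'I_(l.*2.+1)) :
    cintegrable sigma D (fun x => (a l i ord0)^* * ((Ylm i x)^* * v x)).
  by apply: cintegrableM => //; exact: cbmeas_cst.
transitivity (cintegral sigma D (fun x => \sum_(l < L.+1) \sum_(i < l.*2.+1)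
    (a l i ord0)^* * ((Ylm i x)^* * v x))).
  congr cintegral; apply/funext => x.
  rewrite /harmonic_sum rmorph_sum mulr_suml; apply: eq_bigr => l _.
  rewrite rmorph_sum mulr_suml; apply: eq_bigr => i _.
  by rewrite rmorphM mulrA.
rewrite cintegral_sum //; last by move=> l; apply: cintegrable_sum.
apply: eq_bigr => l _; rewrite cintegral_sum // /hdot.
by apply: eq_bigr => i _; rewrite cintegralZ // mxE.
Qed.

Lemma cintegral_harmonic_sumr a L (u : sphere R -> R[i]) : cbmeas u ->
  cintegral sigma D (fun x => u x * harmonic_sum a L x) =
  \sum_(l < L.+1) \sum_(i < l.*2.+1) a l i ord0 * cintegral sigma D (fun x => u x * Ylm i x).
Proof.
move=> bu.
have iuY l (i : 'I_(l.*2.+1)) : cintegrable sigma D (fun x => u x * Ylm i x).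
  by apply: cintegrable_surface; apply: cbmeasM => //; exact: cbmeas_Ylm.
have iauY l (i : 'I_(l.*2.+1)) :
    cintegrable sigma D (fun x => a l i ord0 * (u x * Ylm i x)).
  by apply: cintegrableM => //; exact: cbmeas_cst.
transitivity (cintegral sigma D (fun x => \sum_(l < L.+1) \sum_(i < l.*2.+1)
    a l i ord0 * (u x * Ylm i x))).
  congr cintegral; apply/funext => x.
  rewrite /harmonic_sum mulr_sumr; apply: eq_bigr => l _.
  by rewrite mulr_sumr; apply: eq_bigr => i _; rewrite mulrCA.
rewrite cintegral_sum //; last by move=> l; apply: cintegrable_sum.
apply: eq_bigr => l _; rewrite cintegral_sum //.
by apply: eq_bigr => i _; rewrite cintegralZ.
Qed.

End domain.

Lemma fourier_coefficient a L l (i : 'I_(l.*2.+1)) : (l <= L)%N ->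
  cintegral sigma setT (fun x => (Ylm i x)^* * harmonic_sum a L x) =
  a l i ord0 * (Ylm_norm2 R i)%:C.
Proof.
move=> lL; rewrite cintegral_harmonic_sumr //; last first.
  by apply: cbmeas_conj; exact: cbmeas_Ylm.
have lL1 : (l < L.+1)%N by [].
rewrite (bigD1 (Ordinal lL1)) //= (bigD1 i) //= Ylm_norm2E.
rewrite big1 ?addr0; last first.
  move=> j ji; rewrite Ylm_orthogonal ?mulr0 //; right.
  apply: contra ji => /eqP ij; apply/eqP/val_inj.
  by move: ij; rewrite /order_of => /addIr [].
rewrite big1 ?addr0 // => l' l'l; rewrite big1 // => j _.
rewrite Ylm_orthogonal ?mulr0 //; left; apply: contra l'l => /eqP ll'.
by apply/eqP/val_inj.
Qed.

Lemma parseval_harmonic_sum a L :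
  \int[sigma]_x (Normc.normc (harmonic_sum a L x) ^+ 2) =
  \sum_(l < L.+1) \sum_(i < l.*2.+1) Normc.normc (a l i ord0) ^+ 2 * Ylm_norm2 R i.
Proof.
transitivity (complex.Re (cintegral sigma setT
   (fun x => (harmonic_sum a L x)^* * harmonic_sum a L x))).
  apply: eq_Rintegral => x _.
  by rewrite conj_conjc Re_mul Re_conjc Im_conjc normc2 mulNr opprK !expr2.
rewrite cintegral_harmonic_suml //; last exact: cintegrable_surface (cbmeas_harmonic_sum _ _).
rewrite Re_sum; apply: eq_bigr => l _; rewrite /hdot Re_sum; apply: eq_bigr => i _.
rewrite mxE fourier_coefficient; last by rewrite -ltnS.
rewrite mulrA Re_mul /= mulr0 subr0; congr (_ * _).
by rewrite conj_conjc Re_mul Re_conjc Im_conjc normc2 mulNr opprK !expr2.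
Qed.

(** By Parseval the two sides differ by the nonnegative contributions of the degrees between L+1 and
    K. *)
Lemma bessel_harmonic_sum a L K : (L <= K)%N ->
  \int[sigma]_x (Normc.normc (harmonic_sum a L x) ^+ 2) <=
  \int[sigma]_x (Normc.normc (harmonic_sum a K x) ^+ 2).
Proof.
move=> LK; rewrite !parseval_harmonic_sum.
pose s l := \sum_(i < l.*2.+1) Normc.normc (a l i ord0) ^+ 2 * Ylm_norm2 R i.
rewrite -!(big_mkord xpredT s) (@big_cat_nat _ _ _ L.+1 0 K.+1) //= lerDl sumr_ge0 // => l _.
apply: sumr_ge0 => i _; rewrite mulr_ge0 ?sqr_ge0 //.
by apply: Rintegral_ge0 => x _; rewrite sqr_ge0.
Qed.

End finite_expansions.

(** * KKT points for a fixed observation *)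

Section pointwise.
Variable R : realType.
Local Notation sigma := (@surface_measure R).
Variables (Gamma : set (sphere R)) (mG : measurable Gamma).
Variable T : sphere R -> R.
Hypothesis iT : sigma.-integrable setT (EFin \o T).
Hypothesis iT2 : sigma.-integrable setT (EFin \o (fun x => T x ^+ 2)).
Implicit Types (a : coefs R) (u : sphere R -> R[i]).

Definition residual u (x : sphere R) : R :=
  Normc.normc ((if x \in Gamma then u x else 0) - (T x)%:C) ^+ 2.

(** The part of |u - T|^2 that depends on [u]. The remaining T^2 occurs both on and off [Gamma], and
    so integrates to [energy T]. *)
Definition quadratic_part u (x : sphere R) : R :=
  Normc.normc (u x) ^+ 2 - 2 * complex.Re ((u x)^* * (T x)%:C).

Let iTG : sigma.-integrable Gamma (EFin \o T).
Proof. exact: integrableS iT. Qed.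

Let ciT : cintegrable sigma Gamma (fun x => (T x)%:C).
Proof. by split => //=; exact: integrable0. Qed.

Let ciuT u : cbmeas u -> cintegrable sigma Gamma (fun x => (u x)^* * (T x)%:C).
Proof. by move=> bu; apply: cintegrableM => //; exact: cbmeas_conj. Qed.

Let ciuv u v : cbmeas u -> cbmeas v -> cintegrable sigma Gamma (fun x => (u x)^* * v x).
Proof.
by move=> bu bv; apply: cintegrable_surface => //; apply: cbmeasM => //; exact: cbmeas_conj.
Qed.

Lemma normc2_conj (z : R[i]) : Normc.normc z ^+ 2 = complex.Re (z^* * z).
Proof. by rewrite conj_conjc Re_mul Re_conjc Im_conjc normc2 mulNr opprK !expr2. Qed.

Let i_normc u : cbmeas u -> sigma.-integrable Gamma (EFin \o (fun x => Normc.normc (u x) ^+ 2)).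
Proof.
move=> bu; rewrite (_ : (fun x => _) = fun x => complex.Re ((u x)^* * u x)).
  by case: (ciuv bu bu).
by apply/funext => x; rewrite normc2_conj.
Qed.

Let i2uT u : cbmeas u ->
  sigma.-integrable Gamma (EFin \o (fun x => 2 * complex.Re ((u x)^* * (T x)%:C))).
Proof.
by move=> bu; apply: integrable_bmeasM => //; [exact: bmeas_cst|case: (ciuT bu)].
Qed.

Lemma integrable_quadratic_part u : cbmeas u ->
  sigma.-integrable Gamma (EFin \o quadratic_part u).
Proof.
by move=> bu; apply: integrableB_real => //; [exact: i_normc|exact: i2uT].
Qed.

Lemma Rintegral_quadratic_part u : cbmeas u ->
  \int[sigma]_(x in Gamma) quadratic_part u x =
  complex.Re (cintegral sigma Gamma (fun x => (u x)^* * u x))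
  - 2 * complex.Re (cintegral sigma Gamma (fun x => (u x)^* * (T x)%:C)).
Proof.
move=> bu; rewrite RintegralB //; try exact: i_normc; try exact: i2uT.
rewrite RintegralZl //; last by case: (ciuT bu).
by congr (_ - _); apply: eq_Rintegral => x _; rewrite normc2_conj.
Qed.

Lemma residualE u x : residual u x = (quadratic_part u \_ Gamma) x + T x ^+ 2.
Proof.
rewrite /residual /quadratic_part patchE; case: ifP => _; last first.
  by rewrite sub0r normc2 /= oppr0 expr0n /= addr0 sqrrN add0r.
rewrite conj_conjc Re_mul Re_conjc Im_conjc /= mulr0 subr0 !normc2 Re_add Im_add Re_opp Im_opp /=.
by rewrite oppr0 addr0; ring.
Qed.

Let i_mkcond u : cbmeas u -> sigma.-integrable setT (EFin \o (quadratic_part u \_ Gamma)).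
Proof.
move=> bu; rewrite -restrict_EFin; apply/(integrable_mkcond _ mG).
exact: integrable_quadratic_part.
Qed.

Lemma integrable_residual u : cbmeas u -> sigma.-integrable setT (EFin \o residual u).
Proof.
move=> bu; rewrite (_ : residual u = fun x => (quadratic_part u \_ Gamma) x + T x ^+ 2).
  by apply: integrableD_real => //; exact: i_mkcond.
by apply/funext => x; rewrite residualE.
Qed.

Lemma Rintegral_residual u : cbmeas u ->
  \int[sigma]_x residual u x = \int[sigma]_(x in Gamma) quadratic_part u x + energy T.
Proof.
move=> bu; under eq_Rintegral do rewrite residualE.
by rewrite RintegralD //; [rewrite -Rintegral_mkcond|exact: i_mkcond].
Qed.

Lemma Yrow_truncE a K (l : 'I_K.+1) :
  Yrow_trunc Gamma (fun l : 'I_K.+1 => a l) l =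
  \col_i cintegral sigma Gamma (fun x => (Ylm i x)^* * harmonic_sum a K x).
Proof.
apply/colP => i; rewrite mxE summxE cintegral_harmonic_sumr //; last first.
  by apply: cbmeas_conj; exact: cbmeas_Ylm.
apply: eq_bigr => l' _; rewrite mxE; apply: eq_bigr => j _.
by rewrite mxE mulrC.
Qed.

Lemma obs_coefsE l :
  obs_coefs Gamma T l = \col_i cintegral sigma Gamma (fun x => (Ylm i x)^* * (T x)%:C).
Proof.
apply/colP => i; rewrite !mxE; congr cintegral.
by apply/funext => x; rewrite mulrC.
Qed.

(** This links optimization and approximation: the entries of Y and of the observed coefficients are
    integrals over [Gamma], so the quadratic constraint is the expanded squared misfit. *)
Lemma constraint_truncE a K :
  constraint_trunc Gamma T (fun l : 'I_K.+1 => a l) =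
  \int[sigma]_x residual (harmonic_sum a K) x.
Proof.
have bf := cbmeas_harmonic_sum a K.
rewrite Rintegral_residual // Rintegral_quadratic_part // /constraint_trunc.
rewrite !cintegral_harmonic_suml //; last exact: cintegrable_surface.
congr (complex.Re _ - 2 * complex.Re _ + _).
- by apply: eq_bigr => l _; rewrite Yrow_truncE.
- by apply: eq_bigr => l _; rewrite obs_coefsE.
Qed.

Lemma hdotZr n (b v : 'cV[R[i]]_n) c : hdot b (c *: v) = c * hdot b v.
Proof. by rewrite /hdot mulr_sumr; apply: eq_bigr => i _; rewrite mxE mulrCA. Qed.

Lemma hdotDr n (b v w : 'cV[R[i]]_n) : hdot b (v + w) = hdot b v + hdot b w.
Proof. by rewrite /hdot -big_split; apply: eq_bigr => i _; rewrite mxE mulrDr. Qed.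

Lemma hdot0l n (v : 'cV[R[i]]_n) : hdot 0 v = 0.
Proof. by rewrite /hdot big1 // => i _; rewrite mxE rmorph0 mul0r. Qed.

Lemma Re_hdot_self n (b : 'cV[R[i]]_n) : complex.Re (hdot b b) = l2norm b ^+ 2.
Proof.
rewrite /l2norm sqr_sqrtr; last by apply: sumr_ge0 => i _; rewrite sqr_ge0.
by rewrite Re_sum; apply: eq_bigr => i _; rewrite normc2_conj.
Qed.

Lemma l2norm_gt0 n (b : 'cV[R[i]]_n) : b != 0 -> 0 < l2norm b.
Proof.
move=> b0; rewrite /l2norm sqrtr_gt0 lt_def sumr_ge0 ?andbT; last first.
  by move=> i _; rewrite sqr_ge0.
apply: contra b0 => /eqP /psumr_eq0P H; apply/eqP/colP => i; rewrite mxE.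
apply: Normc.eq0_normc; apply/eqP; rewrite -sqrf_eq0; apply/eqP.
by apply: H => // j _; rewrite sqr_ge0.
Qed.

(** * Consequences of the truncated KKT conditions *)

Section KKT.
Variables (p eta rho : R) (a : coefs R) (K : nat).
Hypotheses (p_gt0 : 0 < p) (eta_gt1 : 1 < eta) (rhoT : rho < energy T).
Hypothesis aK : forall l, (K < l)%N -> a l = 0.
Hypothesis kkt : scaled_KKT_trunc Gamma p eta rho T (fun l : 'I_K.+1 => a l).

Lemma weight_gt0 l : 0 < weight p eta l.
Proof.
rewrite /weight; case: eqP => // /eqP l0; rewrite mulr_gt0 //.
  by rewrite exprn_gt0 // (lt_trans ltr01).
by rewrite powR_gt0 // ltr0n lt0n.
Qed.

(* The multiplier cannot vanish: otherwise stationarity would kill every block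
   of [a], whereas [0] is not feasible. *)
Lemma KKT_multiplier : exists2 nu, 0 < nu &
  constraint_trunc Gamma T (fun l : 'I_K.+1 => a l) = rho /\
  forall l : 'I_K.+1,
    (p * weight p eta l * l2norm (a l) `^ p)%:C *: a l +
    (2 * nu * l2norm (a l) ^+ 2)%:C *:
       (Yrow_trunc Gamma (fun l : 'I_K.+1 => a l) l - obs_coefs Gamma T l) = 0.
Proof.
have [nu [st co le nu0]] := kkt.
have nu_gt0 : 0 < nu.
  rewrite lt_def nu0 andbT; apply: contraTneq le => nuE; rewrite -ltNge.
  have a0 (l : 'I_K.+1) : a l = 0.
    apply/eqP/negPn/negP => al0; have := st l.
    rewrite nuE mulr0 mul0r scale0r addr0 => /eqP; rewrite scaler_eq0 (negPf al0) orbF.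
    move=> /eqP /(congr1 (@complex.Re R)) /= /eqP; apply/negP.
    by rewrite gt_eqF // !mulr_gt0 ?weight_gt0 ?powR_gt0 ?l2norm_gt0.
  rewrite /constraint_trunc !big1 /=; first by rewrite mulr0 subrr add0r.
  - by move=> l _; rewrite a0 hdot0l.
  - by move=> l _; rewrite a0 hdot0l.
exists nu => //; split=> //; apply/eqP; rewrite -subr_eq0.
by move/eqP: co; rewrite mulf_eq0 gt_eqF.
Qed.

Lemma residual_KKT : \int[sigma]_x residual (harmonic_sum a K) x = rho.
Proof. by rewrite -constraint_truncE; have [nu _ []] := KKT_multiplier. Qed.

(** Pairing the stationarity equation with the block itself makes its first term p beta_l
    ||a_l||^(p+2), which is nonnegative; the second term must balance it, and its factor 2 nu
    ||a_l||^2 is positive for a non-zero block. *)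
Lemma KKT_block_le0 (l : 'I_K.+1) :
  complex.Re (hdot (a l)
    (Yrow_trunc Gamma (fun l : 'I_K.+1 => a l) l - obs_coefs Gamma T l)) <= 0.
Proof.
have [nu nu_gt0 [_ /(_ l)]] := KKT_multiplier; set v := _ - _ => st.
have [al0|al0] := eqVneq (a l) 0; first by rewrite al0 hdot0l.
have n0 := l2norm_gt0 al0.
have := congr1 (fun v => complex.Re (hdot (a l) v)) st.
rewrite hdotDr !hdotZr Re_add !Re_mul /= !mul0r !subr0 Re_hdot_self.
have -> : hdot (a l) 0 = 0 by rewrite /hdot big1 // => i _; rewrite mxE mulr0.
move=> /= /eqP; rewrite addrC addr_eq0 => /eqP E.
rewrite -(@pmulr_rle0 _ (2 * nu * l2norm (a l) ^+ 2)) ?mulr_gt0 ?exprn_gt0 // E oppr_le0.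
by rewrite !mulr_ge0 ?sqr_ge0 ?powR_ge0 // ltW // weight_gt0.
Qed.

Lemma harmonic_sum_stable L x : (K <= L)%N -> harmonic_sum a L x = harmonic_sum a K x.
Proof.
move=> KL; rewrite /harmonic_sum.
pose s l := \sum_(i < l.*2.+1) a l i ord0 * Ylm i x.
rewrite -!(big_mkord xpredT s) (@big_cat_nat _ _ _ K.+1 0 L.+1) //=.
rewrite [X in _ + X]big1_seq ?addr0 // => l; rewrite mem_index_iota => /andP[_ /andP[Kl _]].
by rewrite /s big1 // => i _; rewrite aK // mxE mul0r.
Qed.

(* With [f] the full and [g] the truncated sum,
   |g - T|^2 = |f - T|^2 - 2 Re (conj (f - g) (f - T)) + |f - g|^2, and on [Gamma]
   the middle term integrates to the sum of the blocks of [KKT_block_le0] with l > L. *)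
Lemma residual_ge_KKT L : rho <= \int[sigma]_x residual (harmonic_sum a L) x.
Proof.
have [KL|/ltnW LK] := leqP K L.
  rewrite -residual_KKT le_eqVlt; apply/orP; left; apply/eqP.
  by apply: eq_Rintegral => x _; rewrite /residual harmonic_sum_stable.
set f := harmonic_sum a K; set g := harmonic_sum a L.
have bf : cbmeas f := cbmeas_harmonic_sum a K.
have bg : cbmeas g := cbmeas_harmonic_sum a L.
pose v x := f x - (T x)%:C.
have iv : cintegrable sigma Gamma v.
  by apply: cintegrableB => //; exact: cintegrable_surface.
have ifv : cintegrable sigma Gamma (fun x => (f x)^* * v x).
  by apply: cintegrableM => //; exact: cbmeas_conj.
have igv : cintegrable sigma Gamma (fun x => (g x)^* * v x).
  by apply: cintegrableM => //; exact: cbmeas_conj.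
pose r x := complex.Re ((f x)^* * v x) - complex.Re ((g x)^* * v x).
have ir : sigma.-integrable Gamma (EFin \o r).
  by apply: integrableB_real => //; [case: ifv|case: igv].
have r_le0 : \int[sigma]_(x in Gamma) r x <= 0.
  rewrite RintegralB //; [|by case: ifv|by case: igv].
  have -> : \int[sigma]_(x in Gamma) complex.Re ((f x)^* * v x) =
    complex.Re (cintegral sigma Gamma (fun x => (f x)^* * v x)) by [].
  have -> : \int[sigma]_(x in Gamma) complex.Re ((g x)^* * v x) =
    complex.Re (cintegral sigma Gamma (fun x => (g x)^* * v x)) by [].
  rewrite !cintegral_harmonic_suml //.
  pose s l := hdot (a l) (\col_i cintegral sigma Gamma (fun x => (Ylm i x)^* * v x)).
  rewrite -!(big_mkord xpredT s) (@big_cat_nat _ _ _ L.+1 0 K.+1) //=.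
  rewrite Re_add [X in X - _]addrC addrK Re_sum big_nat_cond sumr_le0 // => l /andP[/andP[_ lK] _].
  have := KKT_block_le0 (Ordinal lK); congr (complex.Re (hdot _ _) <= 0).
  rewrite /= Yrow_truncE obs_coefsE; apply/colP => i; rewrite !mxE.
  have iYf : cintegrable sigma Gamma (fun x => (Ylm i x)^* * f x).
    by apply: cintegrable_surface => //; apply: cbmeasM => //; apply: cbmeas_conj; exact: cbmeas_Ylm.
  have iYT : cintegrable sigma Gamma (fun x => (Ylm i x)^* * (T x)%:C).
    by apply: cintegrableM => //; apply: cbmeas_conj; exact: cbmeas_Ylm.
  rewrite -cintegralB //; congr cintegral.
  by apply/funext => x; rewrite mulrBr.
rewrite -residual_KKT !Rintegral_residual // lerD2r.
have H : \int[sigma]_(x in Gamma) (quadratic_part f x - 2 * r x) <=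
  \int[sigma]_(x in Gamma) quadratic_part g x.
  apply: le_Rintegral => //.
  - apply: integrableB_real => //; first exact: integrable_quadratic_part.
    by apply: integrable_bmeasM => //; exact: bmeas_cst.
  - exact: integrable_quadratic_part.
  - move=> x _; rewrite -subr_ge0 /quadratic_part /r /v.
    rewrite !conj_conjc !Re_mul !Re_conjc !Im_conjc !Re_add !Im_add !Re_opp !Im_opp /= !normc2.
    set fr := complex.Re _; set fi := complex.Im _.
    set gr := complex.Re _; set gi := complex.Im _.
    rewrite (_ : _ - _ = (fr - gr) ^+ 2 + (fi - gi) ^+ 2); last by ring.
    by rewrite addr_ge0 ?sqr_ge0.
apply: le_trans H; rewrite [leRHS]RintegralB //; last 2 first.
- exact: integrable_quadratic_part.
- by apply: integrable_bmeasM => //; exact: bmeas_cst.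
rewrite RintegralZl // lerBrDr gerDl.
by rewrite pmulr_rle0.
Qed.

End KKT.
End pointwise.

(** * Random fields *)

Lemma cLnorm2_sqr d (T : measurableType d) (R : realType)
    (mu : {measure set T -> \bar R}) (f : T -> R[i]) :
  (cLnorm mu 2%:E f ^+ 2 = \int[mu]_x (Normc.normc (f x) ^+ 2)%:E)%E.
Proof.
rewrite /cLnorm.
have sqrE (x : \bar R) : (0 <= x -> x ^+ 2 = x `^ 2)%E.
  case: x => [r|_|//]; last by rewrite poweRyr ?pnatr_eq0 // expe2 mulyy.
  by rewrite lee_fin => r0; rewrite poweR_EFin -EFin_expe powR_mulrn.
rewrite sqrE ?Lnorm_ge0 // poweR_Lnorm ?pnatr_eq0 //; apply: eq_integral => x _.
have n0 : 0 <= Normc.normc (f x) by case: (f x) => u v; exact: sqrtr_ge0.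
by rewrite gee0_abs ?lee_fin // poweR_EFin powR_mulrn.
Qed.

Section random_expansion.
Context (R : realType) (d : measure_display) (Omega : measurableType d).
Variable P : probability Omega R.
Local Notation sigma := (@surface_measure R).
Local Notation mu := (P \x sigma)%E.

Lemma prod_measure_setT_fin : mu setT \is a fin_num.
Proof.
have -> : mu setT = (P setT * sigma setT)%E by rewrite -product_measure1E // setXTT.
by rewrite fin_numM // fin_num_measure.
Qed.

(* An infinite energy would be read as [fine +oo = 0]. *)
Lemma Lfun2_section_integrable (T : Omega * sphere R -> R) w :
  measurable_fun setT T ->
  0 < energy (fun x => T (w, x)) ->
  sigma.-integrable setT (EFin \o (fun x => T (w, x) ^+ 2)) /\
  sigma.-integrable setT (EFin \o (fun x => T (w, x))).
Proof.
move=> mT e0.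
have mTw : measurable_fun setT (fun x => T (w, x)) by exact: measurable_fun_pair2.
have i2 : sigma.-integrable setT (EFin \o (fun x => T (w, x) ^+ 2)).
  apply/integrableP; split; first exact/measurable_EFinP/measurable_funX.
  rewrite (eq_integral (fun x => (T (w, x) ^+ 2)%:E)); last first.
    by move=> x _; rewrite gee0_abs // lee_fin sqr_ge0.
  rewrite ltey; apply/eqP => Iy; move: e0.
  by rewrite /energy /Rintegral Iy ltxx.
split=> //.
(* On a finite measure space 1 + T^2 is integrable, and it dominates t = |T| because 2 (1 + t^2 - t)
   = 1 + t^2 + (1 - t)^2. *)
have i1 : sigma.-integrable setT (EFin \o (fun x => 1 + T (w, x) ^+ 2)).
  have i0 : sigma.-integrable setT (EFin \o (fun=> 1)).
    exact: finite_measure_integrable_cst.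
  exact: (integrableD_real measurableT i0 i2).
apply: (le_integrable _ _ _ i1) => //; first exact/measurable_EFinP.
move=> x _ /=; rewrite lee_fin [leRHS]ger0_norm ?addr_ge0 ?sqr_ge0 //.
rewrite -subr_ge0 -(@pmulr_rge0 _ 2) // -[T (w, x) ^+ 2]real_normK ?num_real //.
set t := `|_|; rewrite (_ : _ * _ = 1 + t ^+ 2 + (1 - t) ^+ 2); last by ring.
by rewrite !addr_ge0 ?sqr_ge0.
Qed.

Variable alpha : Omega -> coefs R.
Hypothesis alpha_fin : forall w, exists Lw : nat, forall l, (Lw < l)%N -> alpha w l = 0.

(** The partial sums are constant from index K+1 on, so the limit defining the series is
    attained. *)
Lemma field_ofE w K x : (forall l, (K < l)%N -> alpha w l = 0) ->
  field_of alpha (w, x) = harmonic_sum (alpha w) K x.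
Proof.
move=> aK.
have H (g : R[i] -> R) : (forall u v, g (u + v) = g u + g v) -> g 0 = 0 ->
    limn (series (fun l => g (degree_part alpha l (w, x)))) = g (harmonic_sum (alpha w) K x).
  move=> gD g0; apply: lim_near_cst; first exact: Rhausdorff.
  exists K.+1 => // n /= Kn; rewrite /series /= -(big_morph g gD g0); congr g.
  rewrite (@big_cat_nat _ _ _ K.+1 0 n) //= big_mkord.
  rewrite [X in _ + X]big1_seq ?addr0 // => l; rewrite mem_index_iota => /andP[_ /andP[Kl _]].
  by rewrite /degree_part big1 // => i _; rewrite aK // mxE mul0r.
by apply: complex_eq; rewrite /=; apply: H => //; [exact: Re_add|exact: Im_add].
Qed.

Hypothesis field_L2 : cLfun mu 2%:E (field_of alpha).

(** The product measure is finite, hence L2 is contained in L1. *)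
Lemma integrable_field : cintegrable mu setT (field_of alpha).
Proof.
by case: field_L2 => rf jf; split; apply/Lfun1_integrable;
  apply: Lfun_subset12 => //; exact: prod_measure_setT_fin.
Qed.

Lemma cbmeas_snd (u : sphere R -> R[i]) : cbmeas u ->
  cbmeas (fun z : Omega * sphere R => u z.2).
Proof.
move=> [[mr [M rM]] [mi [N iN]]]; split; split.
- exact: (measurableT_comp mr measurable_snd).
- by exists M => z.
- exact: (measurableT_comp mi measurable_snd).
- by exists N => z.
Qed.

(* No measurability of [alpha] is assumed: it is recovered from that of the field,
   by integrating against [Ylm]. *)
Lemma measurable_coefficient l (i : 'I_(l.*2.+1)) :
  measurable_fun setT (fun w => complex.Re (alpha w l i ord0)) /\
  measurable_fun setT (fun w => complex.Im (alpha w l i ord0)).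
Proof.
pose F (z : Omega * sphere R) := (Ylm i z.2)^* * field_of alpha z.
have [rF iF] : cintegrable mu setT F.
  apply: cintegrableM => //; last exact: integrable_field.
  by apply: cbmeas_conj; apply: cbmeas_snd; exact: cbmeas_Ylm.
have coefE w : cintegral sigma setT (fun x => F (w, x)) = alpha w l i ord0 * (Ylm_norm2 R i)%:C.
  (* The cutoff must be large enough both to represent the whole field at [w] and to include degree
     l. *)
  have [Lw aLw] := alpha_fin w; pose K := maxn Lw l.
  rewrite -(@fourier_coefficient _ _ K) ?leq_maxr //; congr cintegral.
  apply/funext => x; rewrite /F (@field_ofE w K) // => m Km.
  by apply: aLw; apply: leq_ltn_trans Km; exact: leq_maxl.
have N0 := Ylm_norm2_neq0 R i.
have mfine (g : Omega -> \bar R) : measurable_fun setT g ->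
    measurable_fun setT (fun w => (Ylm_norm2 R i)^-1 * fine (g w)).
  by move=> mg; apply: measurable_funM => //; exact: measurableT_comp.
split.
- rewrite (_ : (fun w => _) = fun w => (Ylm_norm2 R i)^-1 *
     fine (fubini_F sigma (EFin \o (fun z => complex.Re (F z))) w)).
    apply: mfine; exact: (measurable_fubini_F rF).
  apply/funext => w; have := congr1 (@complex.Re R) (coefE w).
  rewrite /= Re_mul /= mulr0 subr0 => E.
  by rewrite /fubini_F /= -[fine _]/(\int[sigma]_x complex.Re (F (w, x))) E mulrCA mulVf ?mulr1.
- rewrite (_ : (fun w => _) = fun w => (Ylm_norm2 R i)^-1 *
     fine (fubini_F sigma (EFin \o (fun z => complex.Im (F z))) w)).
    apply: mfine; exact: (measurable_fubini_F iF).
  apply/funext => w; have := congr1 (@complex.Im R) (coefE w).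
  rewrite /= Im_mul /= mulr0 add0r => E.
  by rewrite /fubini_F /= -[fine _]/(\int[sigma]_x complex.Im (F (w, x))) E mulrCA mulVf ?mulr1.
Qed.

Definition cmeasurable (u : Omega * sphere R -> R[i]) :=
  measurable_fun setT (fun z => complex.Re (u z)) /\
  measurable_fun setT (fun z => complex.Im (u z)).

Lemma cmeasurable_sum I (r : seq I) (F : I -> Omega * sphere R -> R[i]) :
  (forall i, cmeasurable (F i)) -> cmeasurable (fun z => \sum_(i <- r) F i z).
Proof.
move=> mF; split.
- under eq_fun do rewrite Re_sum.
  by apply: measurable_sum => i; case: (mF i).
- under eq_fun do rewrite Im_sum.
  by apply: measurable_sum => i; case: (mF i).
Qed.

Lemma cmeasurable_field_trunc L : cmeasurable (field_trunc alpha L).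
Proof.
apply: cmeasurable_sum => l; apply: cmeasurable_sum => i.
have [mr mi] := measurable_coefficient i.
have mr' := measurableT_comp mr (@measurable_fst _ _ Omega (sphere R)).
have mi' := measurableT_comp mi (@measurable_fst _ _ Omega (sphere R)).
have [[mYr _] [mYi _]] := cbmeas_snd (cbmeas_Ylm R i).
split.
- under eq_fun do rewrite Re_mul.
  by apply: measurable_funB; apply: measurable_funM.
- under eq_fun do rewrite Im_mul.
  by apply: measurable_funD; apply: measurable_funM.
Qed.

(** * Domination and convergence of the expected misfit *)

Variables (Gamma : set (sphere R)) (mG : measurable Gamma).
Variable T : Omega * sphere R -> R.
Hypothesis mT : measurable_fun setT T.

Definition field_residual (L : nat) (z : Omega * sphere R) : R :=
  Normc.normc (inpainting Gamma (field_trunc alpha L) z - (T z)%:C) ^+ 2.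

Lemma field_residualE L w x :
  field_residual L (w, x) = residual Gamma (fun x => T (w, x)) (harmonic_sum (alpha w) L) x.
Proof. by []. Qed.

Lemma measurable_field_residual L : measurable_fun setT (field_residual L).
Proof.
have [mr mi] := cmeasurable_field_trunc L.
pose g z := complex.Re (field_trunc alpha L z).
pose h z := complex.Im (field_trunc alpha L z).
rewrite (_ : field_residual L = fun z =>
    \1_Gamma z.2 * (g z ^+ 2 + h z ^+ 2 - 2 * (g z * T z)) + T z ^+ 2).
  apply: measurable_funD; last exact: measurable_funX.
  apply: measurable_funM.
    exact: (measurableT_comp (measurable_indic mG) measurable_snd).
  apply: measurable_funB; first by apply: measurable_funD; exact: measurable_funX.
  by apply: measurable_funM => //; exact: measurable_funM.
apply/funext => -[w x]; rewrite field_residualE residualE patchE indicE.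
case: ifP => _; rewrite ?mul0r // mul1r /quadratic_part conj_conjc Re_mul Re_conjc Im_conjc normc2 /=.
by rewrite mulr0 subr0.
Qed.

(** On [Gamma] the difference of the two sides is |u + t|^2; off [Gamma] the left side is just
    t^2. *)
Lemma residual_le (u : sphere R -> R[i]) (t : sphere R -> R) x :
  residual Gamma t u x <= 2 * Normc.normc (u x) ^+ 2 + 2 * t x ^+ 2.
Proof.
have normc_ge0 : 0 <= Normc.normc (u x) ^+ 2 by rewrite sqr_ge0.
rewrite /residual; case: ifP => _; last first.
  rewrite sub0r normc2 /= oppr0 expr0n /= addr0 sqrrN.
  rewrite -subr_ge0 (_ : _ - _ = 2 * Normc.normc (u x) ^+ 2 + t x ^+ 2); last by ring.
  by rewrite addr_ge0 ?sqr_ge0 // mulr_ge0.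
rewrite -subr_ge0 !normc2 Re_add Im_add Re_opp Im_opp /=.
rewrite (_ : _ - _ = (complex.Re (u x) + t x) ^+ 2 + complex.Im (u x) ^+ 2); last by ring.
by rewrite addr_ge0 ?sqr_ge0.
Qed.

Hypothesis T_L2 : T \in Lfun mu 2%:E.

(** Built from the full field, so that it is independent of the truncation degree and integrable by
    the L2 assumptions. *)
Definition dominating (z : Omega * sphere R) : R :=
  2 * Normc.normc (field_of alpha z) ^+ 2 + 2 * T z ^+ 2.

Lemma integrable_dominating : mu.-integrable setT (EFin \o dominating).
Proof.
have b2 : bmeas (fun _ : Omega * sphere R => 2 : R) by exact: bmeas_cst.
have [rf jf] := field_L2.
apply: integrableD_real => //.
  rewrite (_ : (fun z => _) = fun z => 2 * (complex.Re (field_of alpha z) ^+ 2 +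
     complex.Im (field_of alpha z) ^+ 2)).
    apply: integrable_bmeasM => //; apply: integrableD_real => //.
      exact: (Lfun2_integrable_sqr rf).
    exact: (Lfun2_integrable_sqr jf).
  by apply/funext => z; rewrite normc2.
by apply: integrable_bmeasM => //; exact: Lfun2_integrable_sqr.
Qed.

Variable rho : R.
Hypothesis T_energy : forall w, 0 < energy (fun x => T (w, x)).
Hypothesis residual_ge : forall w L,
  rho <= \int[sigma]_x field_residual L (w, x).
Hypothesis residual_eq : forall w, exists K, forall L, (K <= L)%N ->
  \int[sigma]_x field_residual L (w, x) = rho.

Lemma fubini_F_residual L w :
  fubini_F sigma (EFin \o field_residual L) w =
  (\int[sigma]_x field_residual L (w, x))%:E.
Proof.
rewrite /fubini_F /Rintegral fineK //; apply: integrable_fin_num => //.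
have [i2 i1] := Lfun2_section_integrable mT (T_energy w).
have := integrable_residual mG i1 i2 (cbmeas_harmonic_sum (alpha w) L).
by apply: eq_integrable.
Qed.

(** Truncations are not bounded pointwise on the sphere by the full field; the domination is
    obtained only after integrating over the sphere, through Bessel's inequality. *)
Lemma residual_le_dominating L w :
  (fubini_F sigma (EFin \o field_residual L) w <= fubini_F sigma (EFin \o dominating) w)%E.
Proof.
have [Lw aLw] := alpha_fin w; pose K := maxn Lw L.
have [i2 i1] := Lfun2_section_integrable mT (T_energy w).
have ih M : sigma.-integrable setT
    (EFin \o (fun x => Normc.normc (harmonic_sum (alpha w) M x) ^+ 2)).
  rewrite (_ : (fun x => _) = fun x =>
    complex.Re ((harmonic_sum (alpha w) M x)^* * harmonic_sum (alpha w) M x)).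
    have bh := cbmeas_harmonic_sum (alpha w) M.
    by have [] := cintegrable_surface measurableT (cbmeasM (cbmeas_conj bh) bh).
  by apply/funext => x; rewrite normc2_conj.
have b2 : bmeas (fun _ : sphere R => 2 : R) by exact: bmeas_cst.
have i2h M := integrable_bmeasM measurableT b2 (ih M).
have i2T := integrable_bmeasM measurableT b2 i2.
rewrite fubini_F_residual.
have -> : fubini_F sigma (EFin \o dominating) w =
    (\int[sigma]_x (2 * Normc.normc (harmonic_sum (alpha w) K x) ^+ 2 + 2 * T (w, x) ^+ 2))%:E.
  rewrite /Rintegral fineK; last first.
    by apply: integrable_fin_num => //; exact: (integrableD_real measurableT (i2h K) i2T).
  apply: eq_integral => x _; rewrite /= /dominating (@field_ofE w K) // => m Km.
  by apply: aLw; apply: leq_ltn_trans Km; exact: leq_maxl.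
rewrite lee_fin; apply: (@le_trans _ _
   (\int[sigma]_x (2 * Normc.normc (harmonic_sum (alpha w) L x) ^+ 2 + 2 * T (w, x) ^+ 2))).
  apply: le_Rintegral => //.
  - exact: (integrable_residual mG i1 i2 (cbmeas_harmonic_sum (alpha w) L)).
  - exact: (integrableD_real measurableT (i2h L) i2T).
  - by move=> x _; exact: (residual_le (harmonic_sum (alpha w) L) (fun x => T (w, x)) x).
rewrite !RintegralD // lerD2r !RintegralZl // ler_wpM2l //.
by apply: bessel_harmonic_sum; exact: leq_maxr.
Qed.

Lemma integral_cst_probability (r : R) : (\int[P]_w cst r%:E w)%E = r%:E.
Proof.
rewrite integral_cst // -[RHS]mule1; congr (_ * _)%E; exact: probability_setT.
Qed.

(** Tonelli turns the integral into the expectation of the misfit over the sphere. For each outcome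
    this misfit is eventually equal to [rho], but from a degree depending on the outcome, so
    dominated convergence is applied over [Omega]. *)
Lemma integral_residual_cvg :
  (\int[mu]_z (field_residual L z)%:E)%E @[L --> \oo] --> rho%:E.
Proof.
have mres L : measurable_fun setT (EFin \o field_residual L).
  by apply/measurable_EFinP; exact: measurable_field_residual.
have res0 L z : (0 <= (EFin \o field_residual L) z)%E by rewrite lee_fin sqr_ge0.
have mF L : measurable_fun setT (fubini_F sigma (EFin \o field_residual L)).
  exact: measurable_fun_fubini_tonelli_F.
have dom0 z : (0 <= (EFin \o dominating) z)%E.
  by rewrite lee_fin addr_ge0 // mulr_ge0 ?sqr_ge0.
have iG : P.-integrable setT (fubini_F sigma (EFin \o dominating)).
  apply/integrableP; split; first exact: (measurable_fubini_F integrable_dominating).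
  rewrite (eq_integral (fubini_F sigma (EFin \o dominating))); last first.
    by move=> w _; rewrite gee0_abs // integral_ge0.
  rewrite (integral12_prod_meas1 integrable_dominating).
  rewrite -ge0_fin_numE; last by apply: integral_ge0 => z _; exact: dom0.
  exact: integrable_fin_num integrable_dominating.
have [] := @dominated_convergence _ _ _ P setT measurableT
  (fun L => fubini_F sigma (EFin \o field_residual L)) (cst rho%:E) _ mF _ _ iG _.
- exact: measurable_cst.
- apply: aeW => w _; apply: cvg_near_cst.
  have [K HK] := residual_eq w; exists K => // L /= KL.
  by rewrite fubini_F_residual HK.
- apply: aeW => w L _; rewrite gee0_abs; first exact: residual_le_dominating.
  by apply: integral_ge0 => x _; exact: res0.
move=> _ _; rewrite integral_cst_probability.
rewrite (_ : (fun L => (\int[mu]_z (field_residual L z)%:E)%E) =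
  fun L => (\int[P]_w fubini_F sigma (EFin \o field_residual L) w)%E) //.
by apply/funext => L; exact: (fubini_tonelli1 (EFin \o field_residual L)).
Qed.

Lemma integral_residual_ge L : (rho%:E <= \int[mu]_z (field_residual L z)%:E)%E.
Proof.
have mres : measurable_fun setT (EFin \o field_residual L).
  by apply/measurable_EFinP; exact: measurable_field_residual.
have res0 z : (0 <= (EFin \o field_residual L) z)%E by rewrite lee_fin sqr_ge0.
rewrite (fubini_tonelli1 (EFin \o field_residual L)) //.
(* Monotonicity of the integral is applied to nonnegative functions; for negative [rho] the bound
   follows from nonnegativity of the residual. *)
have [rho0|rho0] := leP 0 rho; last first.
  apply: (@le_trans _ _ 0%E); first by rewrite lee_fin ltW.
  by apply: integral_ge0 => w _; apply: integral_ge0 => x _; exact: res0.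
have -> : rho%:E = (\int[P]_w cst rho%:E w)%E by rewrite integral_cst_probability.
have mF : measurable_fun setT (fubini_F sigma (EFin \o field_residual L)).
  exact: measurable_fun_fubini_tonelli_F.
apply: ge0_le_integral; [exact: measurableT| |exact: measurable_cst|exact: mF|] => w _.
  by rewrite lee_fin.
by rewrite fubini_F_residual lee_fin residual_ge.
Qed.

End random_expansion.

Theorem theorem7 (R : realType) (d : measure_display) (Omega : measurableType d)
    (P : probability Omega R)
    (Gamma : set (sphere R))
    (Gamma_meas : measurable Gamma)
    (Gamma_open : exists U : set (sphere R), [/\ open U, U !=set0 & U `<=` Gamma])
    (Gamma_proper : ~` Gamma !=set0)
    (p eta rho : R)
    (p_gt0 : 0 < p) (p_lt1 : p < 1) (eta_gt1 : 1 < eta)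
    (Ttrue Delta Tobs : Omega * sphere R -> R)
    (Ttrue_L2 : Ttrue \in Lfun (P \x surface_measure)%E 2%:E)
    (Ttrue_inv : rotation_invariant_moments P Ttrue)
    (Tobs_def : forall z, Tobs z = inpainting Gamma Ttrue z + Delta z)
    (Tobs_L2 : Tobs \in Lfun (P \x surface_measure)%E 2%:E)
    (rho_gt : forall w : Omega,
       \int[surface_measure]_(x in ~` Gamma) (Tobs (w, x) ^+ 2) < rho)
    (rho_lt : forall w : Omega, rho < energy (fun x => Tobs (w, x)))
    (alpha : Omega -> coefs R)
    (alpha_KKT : forall w : Omega,
       scaled_KKT Gamma p eta rho (fun x => Tobs (w, x)) (alpha w))
    (alpha_fin : forall w : Omega, exists Lw : nat,
       (forall l : nat, (Lw < l)%N -> alpha w l = 0) /\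
       scaled_KKT_trunc Gamma p eta rho (fun x => Tobs (w, x))
         (fun l : 'I_Lw.+1 => alpha w l))
    (Tstar_L2 : cLfun (P \x surface_measure)%E 2%:E (field_of alpha))
    (eps : R) (eps_gt0 : 0 < eps) :
  exists L : nat,
    (0 <= cLnorm (P \x surface_measure) 2%:E
            (fun z => (inpainting Gamma (field_trunc alpha L) z
                       - (Tobs z)%:C)%R) ^+ 2 - rho%:E < eps%:E)%E.
Proof.
have mT : measurable_fun setT Tobs.
  by move: Tobs_L2; rewrite inE => /andP[]; rewrite inE.
(* [rho] exceeds an integral of squares, so it is positive. Strict positivity of the energy also
   certifies that the section is square integrable. *)
have T_energy w : 0 < energy (fun x => Tobs (w, x)).
  apply: lt_trans (rho_lt w); apply: le_lt_trans (rho_gt w).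
  by apply: Rintegral_ge0 => x _; rewrite sqr_ge0.
have a_fin w : exists Lw : nat, forall l, (Lw < l)%N -> alpha w l = 0.
  by have [Lw [aLw _]] := alpha_fin w; exists Lw.
have res_ge w L : rho <= \int[@surface_measure R]_x field_residual alpha Gamma Tobs L (w, x).
  have [i2 i1] := Lfun2_section_integrable mT (T_energy w).
  have [Lw [aLw kkt]] := alpha_fin w.
  exact: (residual_ge_KKT Gamma_meas i1 i2 p_gt0 eta_gt1 (rho_lt w) aLw kkt).
have res_eq w : exists K, forall L, (K <= L)%N ->
    \int[@surface_measure R]_x field_residual alpha Gamma Tobs L (w, x) = rho.
  have [i2 i1] := Lfun2_section_integrable mT (T_energy w).
  have [Lw [aLw kkt]] := alpha_fin w; exists Lw => L LwL.
  rewrite -(residual_KKT Gamma_meas i1 i2 p_gt0 eta_gt1 (rho_lt w) kkt).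
  by apply: eq_Rintegral => x _; rewrite field_residualE /residual (harmonic_sum_stable aLw).
have cvg_res := integral_residual_cvg a_fin Tstar_L2 Gamma_meas mT Tobs_L2 T_energy res_eq.
have [L _ lt_res] : nbhs \oo [set L | (\int[(P \x (@surface_measure R))%E]_z
    (field_residual alpha Gamma Tobs L z)%:E < rho%:E + eps%:E)%E].
  (* The extended reals below rho + eps form a neighbourhood of [rho]; the threshold index of the
     resulting eventual bound serves as L. *)
  apply: (cvg_res [set y | (y < (rho + eps)%:E)%E]).
  by apply: (@nbhs_open_ereal_lt _ rho (fun r => r + eps)); rewrite ltrDl.
exists L; rewrite cLnorm2_sqr; apply/andP; split.
  rewrite sube_ge0 //; exact: (integral_residual_ge a_fin Tstar_L2 Gamma_meas mT T_energy res_ge).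
rewrite lteBlDr // addeC; exact: (lt_res L (leqnn L)).
Qed.
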